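(* Let $k\ge1$ and let $\mathbf a=(a_1,\dots,a_k)$, $\mathbf b=(b_1,\dots,b_k)$ be vectors of positive integers with $a_1\le a_2\le\dots\le a_k$; let $n=b_1+\dots+b_k$, and let $P\subset\mathbb{R}^n$ be the associated polytope. Then $\dim P=n$, i.e. the secant variety $\sigma_2(X)$ of the Segre-Veronese variety $X=v_{a_1}(\mathbb{P}^{b_1})\times\dots\times v_{a_k}(\mathbb{P}^{b_k})$ is of expected dimension $2n+1$, unless (D1) $k=2$, $\mathbf a=(1,1)$, or (D2) $k=1$, $a_1\le2$, in which case $P=F$. In the full-dimensional case ($\dim P=n$) all the sets $F$, $R_i$ $(1\le i\le k)$ and $Z_{i,j}$ $(1\le i\le k,\ 1\le j\le b_i)$ define facets of $P$, unless: (E1) $k=3$, $b_i=1$ for some $i$ and $a_j=1$ for all $j\ne i$, when $Z_{i,1}$ is not a facet, (E2) $k=2$, $b_1=1$, $a_1\le2$, $a_2=2$, when $Z_{1,1}$ is not a facet, (E3) $k=2$, $b_2=1$, $a_1\le2$, $a_2\ge2$, when $Z_{2,1}$ is not a facet, and (E4) $k=1$, $b_1=1$, $a_1\ge3$, when $Z_{1,1}$ is not a facet.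
   Context: The coordinates of $\mathbb{R}^n$ are $x_{i,j}$ with $1\le i\le k$, $1\le j\le b_i$. The polytope $P$ is the convex hull of the finite set of all $\mathbf c=(c_{i,j})\in\mathbb{N}^n$ with $\sum_{j=1}^{b_i}c_{i,j}\le a_i$ for all $i$ and $\sum_{i,j}c_{i,j}\ge2$. Define $F=\{x\in P:\sum_{i,j}x_{i,j}=2\}$; $R_i=\{x\in P:\sum_{j=1}^{b_i}x_{i,j}=a_i\}$ for $1\le i\le k$; $Z_{i,j}=\{x\in P:x_{i,j}=0\}$ for $1\le i\le k$, $1\le j\le b_i$. The Segre-Veronese variety $X$ is the image of $\mathbb{P}^{b_1}\times\dots\times\mathbb{P}^{b_k}$ (over $\mathbb{C}$) under the embedding by the complete linear system of $\mathcal{O}(a_1,\dots,a_k)$, and $\sigma_2(X)$ is the Zariski closure of the union of all lines through two distinct points of $X$. The sets listed in (E1)–(E4) are the only ones among $F,R_i,Z_{i,j}$ that fail to be facets in the full-dimensional case. *)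

(* Defs.v *)
From HB Require Import structures.
From mathcomp Require Import all_boot all_order all_algebra.
From mathcomp Require Import boolp classical_sets reals complex mpoly.

Set Implicit Arguments.
Unset Strict Implicit.
Unset Printing Implicit Defensive.

Import Order.TTheory GRing.Theory Num.Theory.

Local Open Scope classical_set_scope.
Local Open Scope ring_scope.

Section ConvexGeometry.
Context {R : realType} {V : vectType R}.

Definition conv_hull (S : set V) : set V :=
  [set x | exists m (y : 'I_m -> V) (t : 'I_m -> R),
     [/\ forall l, S (y l), forall l, 0 <= t l, \sum_l t l = 1
       & x = \sum_l t l *: y l]].

Definition affine_hull (S : set V) : set V :=
  [set x | exists m (y : 'I_m -> V) (t : 'I_m -> R),
     [/\ forall l, S (y l), \sum_l t l = 1 & x = \sum_l t l *: y l]].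

(* [affine_dim S d]: the affine hull of S has dimension d; the empty set has
   dimension -1, whence the type int. *)
Definition affine_dim (S : set V) (d : int) : Prop :=
  (S = set0 /\ d = -1) \/
  (exists (p : V) (U : {vspace V}),
     affine_hull S = [set p + u | u in [set u | u \in U]] /\ d = (\dim U)%:Z).

Definition face (Q P : set V) : Prop :=
  exists (f : {linear V -> R^o}) (c : R),
    (forall x, P x -> f x <= c) /\ Q = [set x | P x /\ f x = c].

Definition facet (Q P : set V) : Prop :=
  face Q P /\ exists d : int, affine_dim P d /\ affine_dim Q (d - 1).

End ConvexGeometry.

Section Polytope.
Context (R : realType) {k : nat} (a b : k.-tuple nat).

Definition coord_index : finType := {i : 'I_k & 'I_(tnth b i)}.

Definition ij (i : 'I_k) (j : 'I_(tnth b i)) : coord_index :=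
  Tagged (fun i : 'I_k => 'I_(tnth b i)) j.

Definition polytope_generators : set {ffun coord_index -> R^o} :=
  [set x | exists c : {ffun coord_index -> nat},
     [/\ forall i : 'I_k, (\sum_(j < tnth b i) c (ij j) <= tnth a i)%N,
         (2 <= \sum_(t : coord_index) c t)%N
       & x = [ffun t => (c t)%:R]]].

Definition polytopeP : set {ffun coord_index -> R^o} :=
  conv_hull polytope_generators.

Definition faceF : set {ffun coord_index -> R^o} :=
  [set x | polytopeP x /\ \sum_(t : coord_index) x t = 2].

Definition faceR (i : 'I_k) : set {ffun coord_index -> R^o} :=
  [set x | polytopeP x /\ \sum_(j < tnth b i) x (ij j) = (tnth a i)%:R].

Definition faceZ (i : 'I_k) (j : 'I_(tnth b i)) :
    set {ffun coord_index -> R^o} :=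
  [set x | polytopeP x /\ x (ij j) = 0].

End Polytope.

Arguments polytope_generators R {k} a b.
Arguments polytopeP R {k} a b.
Arguments faceF R {k} a b.
Arguments faceR R {k} a b i.
Arguments faceZ R {k} a b i j.

(* A subset of the projective space P^(N-1) over K is represented by the set of
   all homogeneous coordinate vectors of its points: a set of nonzero vectors
   of 'rV[K]_N stable under nonzero scalars. *)
Section Projective.
Context {K : fieldType} {N : nat}.

(* Union of the lines spanned by two distinct points of X. *)
Definition secant_lines (X : set 'rV[K]_N) : set 'rV[K]_N :=
  [set z : 'rV[K]_N | z != 0 /\ exists x y : 'rV[K]_N, exists s t : K,
     [/\ X x, X y, (forall c : K, y <> c *: x) & z = s *: x + t *: y]].

Definition proj_closure (S : set 'rV[K]_N) : set 'rV[K]_N :=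
  [set z : 'rV[K]_N | z != 0 /\ forall (d : nat) (p : {mpoly K[N]}), p \is d.-homog ->
     (forall w, S w -> p.@[fun l => w 0 l] = 0) -> p.@[fun l => z 0 l] = 0].

Definition alg_indep_on (Y : set 'rV[K]_N) (m : nat)
    (f : 'I_m -> {mpoly K[N]}) : Prop :=
  forall g : {mpoly K[m]},
    (forall y, Y y -> g.@[fun l => (f l).@[fun h => y 0 h]] = 0) -> g = 0.

(* The dimension of a closed Y is one less than that of its affine cone, i.e.
   than the transcendence degree over K of the homogeneous coordinate ring
   K[x_1, .., x_N] / I(Y): the maximal number of its elements which are
   algebraically independent over K.  No d satisfies this when Y is empty. *)
Definition proj_dim (Y : set 'rV[K]_N) (d : nat) : Prop :=
  (exists f : 'I_d.+1 -> {mpoly K[N]}, alg_indep_on Y f) /\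
  (forall f : 'I_d.+2 -> {mpoly K[N]}, ~ alg_indep_on Y f).

End Projective.

Section SegreVeronese.
Context (K : fieldType) {k : nat} (a b : k.-tuple nat).

(* Homogeneous coordinates on P^(b_1) x ... x P^(b_k): block i is
   u_(i,0), ..., u_(i,b_i). *)
Definition hcoord_index : finType := {i : 'I_k & 'I_(tnth b i).+1}.

Definition hij (i : 'I_k) (j : 'I_(tnth b i).+1) : hcoord_index :=
  Tagged (fun i : 'I_k => 'I_(tnth b i).+1) j.

(* Exponents of the monomials of multidegree (a_1, ..., a_k), which form a basis
   of the global sections of O(a_1, ..., a_k); the bound on the exponents is
   implied by the condition and only serves to get a finite type. *)
Definition sv_monomial : finType :=
  {e : {ffun hcoord_index -> 'I_(\sum_(i < k) tnth a i).+1} |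
     [forall i : 'I_k, \sum_(j < (tnth b i).+1) e (hij j) == tnth a i]%N}.

Definition sv_map (u : {ffun hcoord_index -> K}) : 'rV[K]_#|sv_monomial| :=
  \row_(l < #|sv_monomial|)
    \prod_(t : hcoord_index) u t ^+ (val (enum_val l : sv_monomial) t).

Definition segre_veronese : set 'rV[K]_#|sv_monomial| :=
  [set x | exists (u : {ffun hcoord_index -> K}) (c : K),
     [/\ forall i : 'I_k, exists j : 'I_(tnth b i).+1, u (hij j) != 0,
         c != 0 & x = c *: sv_map u]].

Definition secant_variety : set 'rV[K]_#|sv_monomial| :=
  proj_closure (secant_lines segre_veronese).

End SegreVeronese.

Arguments segre_veronese K {k} a b.
Arguments secant_variety K {k} a b.

(* For tuples the entries a_1, a_2 are [nth 0 a 0], [nth 0 a 1], and the index i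
   of a factor is shifted by one. *)
Section Exceptions.
Context {k : nat} (a b : k.-tuple nat).
Local Open Scope nat_scope.

Definition excD1 : Prop := k = 2 /\ a = [:: 1; 1] :> seq nat.
Definition excD2 : Prop := k = 1 /\ nth 0 a 0 <= 2.

Definition excE1 (i : 'I_k) : Prop :=
  [/\ k = 3, tnth b i = 1 & forall j : 'I_k, j != i -> tnth a j = 1].
Definition excE2 (i : 'I_k) : Prop :=
  [/\ k = 2, nth 0 b 0 = 1, nth 0 a 0 <= 2, nth 0 a 1 = 2 & i = 0 :> nat].
Definition excE3 (i : 'I_k) : Prop :=
  [/\ k = 2, nth 0 b 1 = 1, nth 0 a 0 <= 2, 2 <= nth 0 a 1 & i = 1 :> nat].
Definition excE4 (i : 'I_k) : Prop :=
  [/\ k = 1, nth 0 b 0 = 1, 3 <= nth 0 a 0 & i = 0 :> nat].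

End Exceptions.

(* Main.v *)
Require Import Defs.
From HB Require Import structures.
From mathcomp Require Import all_boot all_order all_algebra.
From mathcomp Require Import boolp classical_sets reals complex mpoly.
From mathcomp Require Import zify ring.

Set Implicit Arguments.
Unset Strict Implicit.
Unset Printing Implicit Defensive.

Import Order.TTheory GRing.Theory Num.Theory.

Local Open Scope classical_set_scope.
Local Open Scope ring_scope.

(** Write A for the sum of the a_i.  Then [excD1] or [excD2] holds exactly when
    A <= 2 ([sum_le2P]), and everything is decided by comparing such capacities
    with 3.

    The polytope.  A lattice point is a multiset of coordinates with at most a_i
    entries in block i ([legal]); it lies in P when its size is at least two.  If
    a legal multiset of size three contains p, removing p stays in P, so the unit
    vector e_p is a direction of the affine hull of P.  When A >= 3 every p lies
    in such a multiset, and dim P = n; when A <= 2 all points have degree two and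
    P = F.  The facets F and R_i are treated by exchanging and removing entries
    of multisets in the same way ([facet_faceF], [facet_faceR]).  On Z_{i,j} the
    coordinate (i,j) is forbidden, so the argument for P applies as soon as the
    remaining coordinates have capacity at least 3; otherwise Z_{i,j} lies in the
    hyperplane where the coordinates sum to 2, and it is too small
    ([facet_faceZ]).  The cases of small capacity are those listed
    in [excE1], ..., [excE4] ([small_complementP]).

    The secant variety.  Both conditions on dimensions are compared with A >= 3.
    The affine cone over the secant variety is parametrized by s sv(u) + t sv(v),
    where u and v may be taken in an affine chart of dimension n
    ([secant_variety_vanishing]); these are 2n + 2 parameters, and more
    polynomials than parameters are dependent, by counting monomials
    ([algebraic_dependence]).  If A <= 2, only the mean and the covariance of the
    two-point distribution (s at u, t at v) matter, and these are also realized
    with s = t; one parameter less is enough ([chord_balance]), so the secant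
    variety is defective.  If A >= 3, take the monomials at distance at most one
    from two opposite monomials prod_i x_{i,0}^{a_i} and prod_i x_{i,b_i}^{a_i}.
    These two families of n + 1 monomials, coordinates on the tangent spaces of X
    at two torus-fixed points, are disjoint because the opposite monomials differ
    in all of their A >= 3 factors.  Along a suitable curve of chords these
    2n + 2 coordinates are dominated by powers of the parameter with exponents
    that separate any given set of monomials; hence they are
    algebraically independent ([leading_exponents],
    [secant_variety_independent]). *)

(** * Polynomials in one and in several variables *)

Section PolynomialTools.
Variable K : numFieldType.
Implicit Types (p q : {poly K}).

(** The product [p * q] vanishes at all natural numbers.  The roots of [q] are meant
    to be the parameter values where a construction degenerates: an identity
    checked at generic points then holds at all points. *)
Lemma poly_eq0_offroots p q :
  q != 0 -> (forall x, ~~ root q x -> p.[x] = 0) -> p = 0.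
Proof.
move=> q0 pq; apply/eqP; apply: contraT => p0.
have pq0 : p * q != 0 by rewrite mulf_neq0.
pose rs := [seq n%:R : K | n <- iota 0 (size (p * q))].
have := @max_poly_roots _ (p * q) rs pq0; rewrite size_map size_iota ltnn.
apply.
- apply/allP => _ /mapP[n _ ->]; rewrite rootM.
  by case: (boolP (root q _)) => [|/pq pn]; rewrite ?orbT // /root pn eqxx.
- by rewrite map_inj_uniq ?iota_uniq // => i j /eqP; rewrite eqr_nat => /eqP.
Qed.

Lemma horner_mmap N (p : {mpoly K[N]}) (Z : 'I_N -> {poly K}) x :
  (mmap (@polyC K) Z p).[x] = p.@[fun l => (Z l).[x]].
Proof.
rewrite /mmap mevalE horner_sum; apply: eq_bigr => m _.
by rewrite hornerM hornerC horner_prod; congr (_ * _);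
   apply: eq_bigr => i _; rewrite horner_exp.
Qed.

Lemma meval_curve_eq0 N (p : {mpoly K[N]}) (Z : 'I_N -> {poly K}) q :
  q != 0 -> (forall x, ~~ root q x -> p.@[fun l => (Z l).[x]] = 0) ->
  forall x, p.@[fun l => (Z l).[x]] = 0.
Proof.
move=> q0 pZ x; rewrite -horner_mmap.
rewrite (@poly_eq0_offroots (mmap (@polyC K) Z p) q q0) ?horner0 //.
by move=> x' /pZ; rewrite -horner_mmap.
Qed.

Lemma msizeM_leq N (p q : {mpoly K[N]}) d e :
  (msize p <= d.+1)%N -> (msize q <= e.+1)%N -> (msize (p * q) <= (d + e).+1)%N.
Proof.
have [->|p0] := eqVneq p 0; first by rewrite mul0r msize0.
have [->|q0] := eqVneq q 0; first by rewrite mulr0 msize0.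
by rewrite msizeM //; move: (msize p) (msize q) => i j; lia.
Qed.

Lemma msize_expr_leq N (p : {mpoly K[N]}) d n :
  (msize p <= d.+1)%N -> (msize (p ^+ n) <= (n * d).+1)%N.
Proof.
move=> pd; elim: n => [|n IH]; first by rewrite expr0 msize1.
by rewrite exprS mulSn msizeM_leq.
Qed.

Lemma msize_prod_leq N (I : finType) (F : I -> {mpoly K[N]}) (d : I -> nat) :
  (forall i, msize (F i) <= (d i).+1)%N ->
  (msize (\prod_i F i) <= (\sum_i d i).+1)%N.
Proof.
move=> Fd; elim/big_ind2: _ => [|p i q j|i _]; rewrite ?msize1 //.
exact: msizeM_leq.
Qed.

End PolynomialTools.

Section AlgebraicDependence.
Variable K : numFieldType.

(** Monomials in the [F j] with exponents below D number D ^ m', whereas they live in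
    a space of polynomials of dimension O(D ^ m); for large D this forces a linear
    relation between them. *)
Lemma algebraic_dependence m m' (F : 'I_m' -> {mpoly K[m]}) :
  (m < m')%N ->
  exists2 g : {mpoly K[m']}, g != 0 &
    forall v : 'I_m -> K, g.@[fun j => (F j).@[v]] = 0.
Proof.
move=> ltmm'.
have leq_exp2r_w x y e : (x <= y -> x ^ e <= y ^ e)%N by case: e => // e; rewrite leq_exp2r.
pose d := (\max_j msize (F j))%N.
(* E <= (m' d + 1) D, and D exceeds (m' d + 1) ^ m, whence E ^ m < D ^ (m + 1). *)
pose D := ((m' * d).+1 ^ m).+1.
pose E := (m' * (D * d)).+1.
have card_lt : (E ^ m < D ^ m')%N.
  have leE : (E <= (m' * d).+1 * D)%N by rewrite /E /D; nia.
  apply: (@leq_ltn_trans (((m' * d).+1 * D) ^ m)); first exact: leq_exp2r_w.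
  rewrite expnMn; apply: (@leq_trans (D ^ m.+1)); last by rewrite leq_pexp2l.
  by rewrite expnS ltn_pmul2r ?expn_gt0.
pose I := {ffun 'I_m' -> 'I_D}; pose J := {ffun 'I_m -> 'I_E}.
pose G (e : I) := \prod_j F j ^+ e j.
pose mn (c : J) := [multinom (c l : nat) | l < m].
pose A : 'M[K]_(#|I|, #|J|) :=
  \matrix_(r, c) (G (enum_val r))@_(mn (enum_val c)).
have : kermx A != 0.
  rewrite kermx_eq0 /row_free neq_ltn (leq_ltn_trans (rank_leq_col A)) //.
  by rewrite !card_ffun !card_ord.
case/rowV0Pn => v /sub_kermxP vA v0.
pose me (e : I) := [multinom (e l : nat) | l < m'].
have me_inj : injective me.
  by move=> e e' /mnmP h; apply/ffunP => l; apply/val_inj; have := h l; rewrite !mnmE.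
pose g : {mpoly K[m']} := \sum_(e : I) v 0 (enum_rank e) *: 'X_[me e].
exists g.
  apply: contraNneq v0 => g0; apply/eqP/rowP => r; rewrite mxE.
  have := congr1 (mcoeff (me (enum_val r))) g0; rewrite mcoeff0 => <-.
  rewrite raddf_sum (bigD1 (enum_val r)) //= big1 => [|e ner].
    by rewrite mcoeffZ mcoeffX eqxx mulr1 enum_valK addr0.
  by rewrite mcoeffZ mcoeffX (inj_eq me_inj) (negPf ner) mulr0.
have Gle e : (msize (G e) <= E)%N.
  apply: (@leq_trans (\sum_j e j * d).+1).
    apply: msize_prod_leq => j; apply: msize_expr_leq.
    by apply: leqW; apply: (leq_bigmax (F := fun j => msize (F j))).
  rewrite ltnS -[X in (_ <= X * _)%N]card_ord -sum_nat_const.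
  by apply: leq_sum => j _; rewrite leq_mul2r ltnW ?orbT.
have G0 : \sum_(e : I) v 0 (enum_rank e) *: G e = 0.
  apply/mpolyP => c; rewrite mcoeff0 raddf_sum /=.
  have [cE|] := boolP [forall l, (c l < E)%N]; last first.
    rewrite negb_forall => /existsP[l]; rewrite -leqNgt => cl.
    rewrite big1 // => e _; rewrite mcoeffZ (memN_msupp_eq0 (msize_mdeg_ge _)) ?mulr0 //.
    by rewrite (leq_trans (Gle e)) // (leq_trans cl) // mdegE (bigD1 l) //= leq_addr.
  pose c' : J := [ffun l => Ordinal (forallP cE l)].
  have -> : c = mn c' by apply/mnmP => l; rewrite mnmE ffunE.
  have := congr1 (fun B : 'rV__ => B 0 (enum_rank c')) vA; rewrite !mxE => {2}<-.
  rewrite (reindex (@enum_rank I)) /=; last by apply/onW_bij/enum_rank_bij.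
  by apply: eq_bigr => e _; rewrite mcoeffZ mxE !enum_rankK.
move=> w; have := congr1 (meval w) G0; rewrite meval0 /g !raddf_sum /= => {2}<-.
apply: eq_bigr => e _; rewrite !mevalZ mevalX /G rmorph_prod; congr (_ * _).
by apply: eq_bigr => j _; rewrite mnmE rmorphXn.
Qed.

End AlgebraicDependence.

(** * Independence of polynomials with separated leading exponents *)

Section LeadingExponents.
Variable K : numFieldType.

Lemma sum_digits_lt N B (d : 'I_N -> nat) :
  (forall i, (d i < B)%N) -> (\sum_i d i * B ^ i < B ^ N)%N.
Proof.
elim: N d => [|N IH] d dB; first by rewrite big_ord0.
rewrite big_ord_recr /= expnSr.
have := IH (fun i => d (widen_ord (leqnSn N) i)) (fun i => dB _); have := dB ord_max.
by move: (\sum_(_ < N) _)%N (B ^ N)%N (d ord_max) => s x e; nia.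
Qed.

Lemma digits_inj N B (d d' : 'I_N -> nat) :
  (forall i, (d i < B)%N) -> (forall i, (d' i < B)%N) ->
  (\sum_i d i * B ^ i = \sum_i d' i * B ^ i)%N -> d =1 d'.
Proof.
elim: N d d' => [|N IH] d d' dB dB' => [_ []//|].
rewrite !big_ord_recr /=.
pose e (f : 'I_N.+1 -> nat) i := f (widen_ord (leqnSn N) i).
have := sum_digits_lt (d := e d) (fun i => dB _).
have := sum_digits_lt (d := e d') (fun i => dB' _).
rewrite /e => lt' lt eq_s.
have eq_max : d ord_max = d' ord_max.
  move: lt lt' eq_s; move: (\sum_(_ < N) _)%N (\sum_(_ < N) _)%N (B ^ N)%N.
  by move: (d ord_max) (d' ord_max) => x y s s' z; nia.
move: eq_s; rewrite eq_max => /addIn /IH eq_e i.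
have [j ->|->//] := unliftP ord_max i.
have -> : lift ord_max j = widen_ord (leqnSn N) j by apply/val_inj; rewrite /= /bump leqNgt ltn_ord.
exact: eq_e.
Qed.

(** The weight of [i] is c i * 4L plus the digit B ^ i, where B exceeds all exponents
    in [g] and L = B ^ N: modulo 4L, the weight of a monomial of [g] is the number
    whose digits are its exponents.  The factor 4 keeps the levels c i apart by
    more than the variations inside a level. *)
Lemma separating_weights N (g : {mpoly K[N]}) (c : 'I_N -> nat) :
  exists (L : nat) (W : 'I_N -> nat),
    [/\ (0 < L)%N, forall i, (c i * (4 * L) <= W i <= c i * (4 * L) + L)%N
      & {in msupp g &, injective (fun m : 'X_{1..N} => \sum_i m i * W i)%N}].
Proof.
pose B := (msize g).+1; exists (B ^ N)%N, (fun i : 'I_N => c i * (4 * B ^ N) + B ^ i)%N.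
have lt_supp m : m \in msupp g -> forall i, (m i < B)%N.
  move=> /msize_mdeg_lt mg i; rewrite ltnS ltnW // (leq_ltn_trans _ mg) //.
  by rewrite mdegE (bigD1 i) //= leq_addr.
split=> [|i|m m' /lt_supp mB /lt_supp m'B].
- by rewrite expn_gt0.
- by rewrite leq_addr leq_add2l leq_pexp2l // ltnW.
under eq_bigr do rewrite mulnDr mulnA.
under [RHS]eq_bigr do rewrite mulnDr mulnA.
rewrite !big_split /= -!big_distrl /= => h.
apply/mnmP; apply: (digits_inj mB m'B).
have := sum_digits_lt mB; have := sum_digits_lt m'B.
have := congr1 (modn^~ (4 * B ^ N)%N) h; rewrite !modnMDl => eqm lt' lt.
have lt4 x : (x < B ^ N -> x < 4 * B ^ N)%N by move: (B ^ N)%N => y; lia.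
by rewrite !modn_small ?lt4 in eqm.
Qed.

(** Exactly one monomial of [g] has minimal weight, and no other term of [g] reaches
    the corresponding power of X along the curve. *)
Lemma leading_exponents N (g : {mpoly K[N]}) (W : 'I_N -> nat)
    (r : 'I_N -> {poly K}) :
  {in msupp g &, injective (fun m : 'X_{1..N} => \sum_i m i * W i)%N} ->
  mmap (@polyC K) (fun i => 'X^(W i) * (1 + 'X * r i)) g = 0 -> g = 0.
Proof.
move=> W_inj g_curve; apply/eqP; apply: contraT => g0.
pose wt (m : 'X_{1..N}) := (\sum_i m i * W i)%N.
have ex_wt : exists w, has (fun m => wt m == w) (msupp g).
  exists (wt (mlead g)); apply/hasP; exists (mlead g) => //.
  exact: mlead_supp.
case: (ex_minnP ex_wt) => w /hasP[m mg /eqP wm] w_min.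
pose Q (m : 'X_{1..N}) := \prod_i (1 + 'X * r i) ^+ m i.
have Q0 m' : (Q m')`_0 = 1.
  rewrite -horner_coef0 horner_prod big1 // => i _.
  by rewrite horner_exp !hornerE expr1n.
have mmap1E m' : mmap1 (fun i => 'X^(W i) * (1 + 'X * r i)) m' = 'X^(wt m') * Q m'.
  rewrite /mmap1 /Q /wt (big_morph _ (@exprD {poly K} 'X) (expr0 _)) -big_split /=.
  by apply: eq_bigr => i _; rewrite exprMn -exprM mulnC.
suff : g@_m = 0 by move/eqP; rewrite mcoeff_eq0 mg.
have := congr1 (fun p : {poly K} => p`_w) g_curve; rewrite /mmap coef0 coef_sum.
rewrite (bigD1_seq m) ?msupp_uniq //= mmap1E coefCM coefXnM wm ltnn subnn Q0 mulr1.
rewrite big_seq_cond big1 ?addr0 // => m' /andP[m'g nem].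
have lt_wt : (w < wt m')%N.
  rewrite ltn_neqAle w_min ?andbT; last by apply/hasP; exists m'.
  by apply: contra nem => /eqP eqw; apply/eqP/W_inj => //; rewrite -/(wt _) -eqw -wm.
by rewrite mmap1E coefCM coefXnM lt_wt mulr0.
Qed.

End LeadingExponents.

(** * Projective closures and charts of the Segre-Veronese variety *)

Section ProjectiveClosure.
Variable K : numFieldType.

Lemma pihomog_meval N d (P : {mpoly K[N]}) (z : 'I_N -> K) c :
  (pihomog mdeg d P).@[fun l => c * z l] = c ^+ d * (pihomog mdeg d P).@[z].
Proof.
rewrite pihomogE !raddf_sum mulr_sumr; apply: eq_bigr => m /eqP <-.
rewrite /= !mevalZ !mevalX mulrCA; congr (_ * _).
rewrite mdegE (big_morph (fun e => c ^+ e) (@exprD _ c) (expr0 _)) -big_split.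
by apply: eq_bigr => i _; rewrite exprMn.
Qed.

(** Only homogeneous polynomials enter the closure, but on the lines through the
    origin in the cone [S] an arbitrary polynomial is a polynomial in the scalar,
    whose coefficients are the values of its homogeneous components. *)
Lemma proj_closure_vanishing N (S : set 'rV[K]_N) (P : {mpoly K[N]}) :
  (forall z c, S z -> c != 0 -> S (c *: z)) ->
  (forall z, S z -> P.@[fun l => z 0 l] = 0) ->
  forall z, proj_closure S z -> P.@[fun l => z 0 l] = 0.
Proof.
move=> S_cone PS z [_ Sz].
have defP := pihomog_partitionE (leqnn (msize P)).
rewrite defP raddf_sum /= big1 // => d _.
apply: (Sz d); first exact: pihomogP.
move=> w Sw;
pose q := \poly_(e < msize P) (pihomog mdeg e P).@[fun l => w 0 l].
suff q0 : q = 0.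
  have := congr1 (fun q : {poly K} => q`_d) q0.
  by rewrite coef_poly ltn_ord coef0.
apply: (@poly_eq0_offroots _ _ 'X); first by rewrite polyX_eq0.
move=> c; rewrite rootX => c0; rewrite horner_poly.
transitivity (P.@[fun l => (c *: w) 0 l]); last exact/PS/S_cone.
rewrite [in RHS]defP raddf_sum /=.
apply: eq_bigr => e _; rewrite mulrC -pihomog_meval.
by apply: meval_eq => l; rewrite mxE.
Qed.

(** The map [phi] is thought of as a parametrization of a dense part of [Y]. *)
Lemma param_alg_dependent N m m' (Y : set 'rV[K]_N) (phi : 'I_N -> {mpoly K[m]}) :
  (m < m')%N ->
  (forall P : {mpoly K[N]}, (forall v, P.@[fun l => (phi l).@[v]] = 0) ->
     forall y, Y y -> P.@[fun l => y 0 l] = 0) ->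
  forall f : 'I_m' -> {mpoly K[N]}, ~ alg_indep_on Y f.
Proof.
move=> ltmm' phi_dense f f_indep.
have [g g0 gF] := algebraic_dependence
  (fun j => f j \mPo [tuple phi l | l < N]) ltmm'.
move/eqP: g0; apply; apply: f_indep => y Yy.
transitivity ((g \mPo [tuple f j | j < m']).@[fun l => y 0 l]).
  by rewrite comp_mpoly_meval; apply: meval_eq => j; rewrite tnth_mktuple.
apply: phi_dense Yy => v.
rewrite comp_mpoly_meval -[RHS](gF v); apply: meval_eq => j.
rewrite tnth_mktuple comp_mpoly_meval; apply: meval_eq => l.
by rewrite tnth_mktuple.
Qed.

End ProjectiveClosure.

Lemma big_tagged (R : Type) (idx : R) (op : Monoid.com_law idx) (I : finType)
    (J : I -> finType) (F : {i : I & J i} -> R) :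
  \big[op/idx]_t F t = \big[op/idx]_i \big[op/idx]_(j : J i) F (Tagged (fun i => J i) j).
Proof.
rewrite (sig_big_dep xpredT (fun _ => xpredT) (fun i j => F (Tagged (fun i => J i) j))).
by apply: eq_bigr => -[].
Qed.

Lemma card_coord_index k (b : k.-tuple nat) :
  #|{: coord_index b}| = (\sum_i tnth b i)%N.
Proof.
rewrite card_tagged sumnE big_map big_enum /=.
by under eq_bigr do rewrite card_ord.
Qed.

Section SecantOfSegreVeronese.
Variables (k : nat) (a b : k.-tuple nat).

Section Coordinates.
Variable A : comNzRingType.
Implicit Types (u : hcoord_index b -> A) (w : coord_index b -> A).

Definition sv_coord u (e : sv_monomial a b) : A :=
  \prod_(t : hcoord_index b) u t ^+ (val e t).

(** The affine chart of the product of projective spaces where no homogeneous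
    coordinate [base i] vanishes. *)
Definition sv_chart (base : forall i : 'I_k, 'I_(tnth b i).+1) w
    (t : hcoord_index b) : A :=
  oapp (fun j => w (ij j)) 1 (unlift (base (tag t)) (tagged t)).

Lemma sv_chart_base base w i : sv_chart base w (hij (base i)) = 1.
Proof. by rewrite /sv_chart /= unlift_none. Qed.

Lemma sv_chart_lift base w i (j : 'I_(tnth b i)) :
  sv_chart base w (hij (lift (base i) j)) = w (ij j).
Proof. by rewrite /sv_chart /= liftK. Qed.

Lemma eq_sv_coord u u' e : u =1 u' -> sv_coord u e = sv_coord u' e.
Proof. by move=> uu'; apply: eq_bigr => t _; rewrite uu'. Qed.

Lemma sv_monomialP (e : sv_monomial a b) i :
  (\sum_(j < (tnth b i).+1) val e (hij j) = tnth a i)%N.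
Proof. by case: e => e /= /forallP/(_ i)/eqP. Qed.

Lemma sv_coord_scale (c : 'I_k -> A) u e :
  sv_coord (fun t => c (tag t) * u t) e = (\prod_i c i ^+ tnth a i) * sv_coord u e.
Proof.
rewrite /sv_coord; under eq_bigr do rewrite exprMn.
rewrite big_split big_tagged; congr (_ * _); apply: eq_bigr => i _.
rewrite -(sv_monomialP e i) /=.
by rewrite (big_morph (fun n => c i ^+ n) (@exprD _ (c i)) (expr0 _)).
Qed.

End Coordinates.

Lemma rmorph_sv_coord (A A' : comNzRingType) (f : {rmorphism A -> A'}) u e :
  f (sv_coord u e) = sv_coord (f \o u) e.
Proof. by rewrite rmorph_prod; apply: eq_bigr => t _; rewrite rmorphXn. Qed.

Variable K : numFieldType.

Lemma sv_coord_chart base (u : hcoord_index b -> K) :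
  (forall i, u (hij (base i)) != 0) ->
  exists (c : K) (w : coord_index b -> K),
    forall e, sv_coord u e = c * sv_coord (sv_chart base w) e.
Proof.
move=> u0; exists (\prod_i u (hij (base i)) ^+ tnth a i).
pose w (p : coord_index b) :=
  u (hij (lift (base (tag p)) (tagged p))) / u (hij (base (tag p))).
exists w => e; rewrite -sv_coord_scale; apply: eq_sv_coord => -[i j].
have [j' -> | ->] := unliftP (base i) j.
  by rewrite -/(hij _) sv_chart_lift /= mulrC divfK.
by rewrite -/(hij _) sv_chart_base mulr1.
Qed.

Lemma secant_lines_cone z (c : K) :
  secant_lines (segre_veronese K a b) z -> c != 0 ->
  secant_lines (segre_veronese K a b) (c *: z).
Proof.
move=> [z0 [x [y [s [t [Xx Xy xy zE]]]]]] c0; split.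
  by rewrite scaler_eq0 negb_or c0.
exists x, y, (c * s), (c * t); split=> //.
by rewrite zE scalerDr !scalerA.
Qed.

Definition chord (A : comNzRingType) (s t : A) (u v : hcoord_index b -> A)
    (l : 'I_#|sv_monomial a b|) : A :=
  s * sv_coord u (enum_val l) + t * sv_coord v (enum_val l).

Lemma horner_chord s t u v (x : K) l :
  (chord s t u v l).[x] =
  chord s.[x] t.[x] (fun i => (u i).[x]) (fun i => (v i).[x]) l.
Proof.
by rewrite /chord -!horner_evalE rmorphD !rmorphM /= !rmorph_sv_coord.
Qed.

(** Adding a small multiple of the base vectors to the endpoints [u] and [v] of a chord
    moves both into the chart; the vanishing is then transported back to [u] and
    [v] along this line. *)
Lemma secant_variety_vanishing base (P : {mpoly K[#|sv_monomial a b|]}) :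
  (forall s t w w',
     P.@[chord s t (sv_chart base w) (sv_chart base w')] = 0) ->
  forall z, secant_variety K a b z -> P.@[fun l => z 0 l] = 0.
Proof.
move=> P0; apply: proj_closure_vanishing; first exact: secant_lines_cone.
move=> z [_ [_ [_ [s [t [[u [c [_ _ ->]]] [v [d [_ _ ->]]] _ zE]]]]]].
rewrite (meval_eq (v2 := chord (s * c) (t * d) u v)); last first.
  by move=> l; rewrite zE !mxE !mulrA.
pose shift (u : hcoord_index b -> K) (t : hcoord_index b) : {poly K} :=
  (u t)%:P + (if tagged t == base (tag t) then 'X else 0).
have shift_base u' i x : (shift u' (hij (base i))).[x] = u' (hij (base i)) + x.
  by rewrite /shift /= eqxx !hornerE.
have shift0 u' t' : (shift u' t').[0] = u' t'.
  by rewrite /shift; case: ifP => _; rewrite !hornerE.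
pose Z := chord (s * c)%:P (t * d)%:P (shift u) (shift v).
pose q := \prod_i (shift u (hij (base i)) * shift v (hij (base i))).
have q0 : q != 0.
  apply/prodf_neq0 => i _; rewrite /shift /= eqxx.
  by rewrite mulf_neq0 // addrC monic_neq0 // monicXaddC.
have := meval_curve_eq0 q0 (p := P) (Z := Z) _ 0.
rewrite (meval_eq (v2 := chord (s * c) (t * d) u v)) => [-> //|l]; last first.
  by rewrite horner_chord !hornerE; congr (_ * _ + _ * _); apply: eq_sv_coord.
move=> x; rewrite /root horner_prod => /prodf_neq0 q_x.
have [c1 [w uE]] : exists c1 w, forall e,
    sv_coord (fun i => (shift u i).[x]) e = c1 * sv_coord (sv_chart base w) e.
  by apply: sv_coord_chart => i; have := q_x i isT; rewrite hornerM mulf_eq0 negb_or => /andP[].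
have [d1 [w' vE]] : exists c1 w, forall e,
    sv_coord (fun i => (shift v i).[x]) e = c1 * sv_coord (sv_chart base w) e.
  by apply: sv_coord_chart => i; have := q_x i isT; rewrite hornerM mulf_eq0 negb_or => /andP[].
rewrite -[RHS](P0 (s * c * c1) (t * d * d1) w w'); apply: meval_eq => l.
by rewrite horner_chord !hornerE /chord uE vE !mulrA.
Qed.

End SecantOfSegreVeronese.

(** * Upper bounds for the dimension of the secant variety *)

Section SecantUpperBounds.
Variables (k : nat) (a b : k.-tuple nat).

Lemma rmorph_chord (A A' : comNzRingType) (f : {rmorphism A -> A'}) s t u v l :
  f (chord (a := a) (b := b) s t u v l) = chord (f s) (f t) (f \o u) (f \o v) l.
Proof. by rewrite rmorphD !rmorphM !rmorph_sv_coord. Qed.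

Lemma rmorph_sv_chart (A A' : comNzRingType) (f : {rmorphism A -> A'}) base
    (w : coord_index b -> A) : f \o sv_chart base w =1 sv_chart base (f \o w).
Proof. by move=> t; rewrite /= /sv_chart; case: unlift => [j|] //=; rewrite rmorph1. Qed.

Lemma eq_sv_chart (A : comNzRingType) base (w w' : coord_index b -> A) :
  w =1 w' -> sv_chart base w =1 sv_chart base w'.
Proof. by move=> ww' t; rewrite /sv_chart; case: unlift => //= j. Qed.

Lemma eq_chord (A : comNzRingType) (s t : A) u u' v v' :
  u =1 u' -> v =1 v' -> chord (a := a) (b := b) s t u v =1 chord s t u' v'.
Proof. by move=> uu' vv' l; rewrite /chord (eq_sv_coord _ uu') (eq_sv_coord _ vv'). Qed.

Definition origin (i : 'I_k) : 'I_(tnth b i).+1 := ord0.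

(** A chord point depends on two scalars and on two points of a chart. *)
Lemma secant_variety_dependent (K : numFieldType) m' :
  (2 * (\sum_i tnth b i).+1 < m')%N ->
  forall f : 'I_m' -> {mpoly K[#|sv_monomial a b|]},
    ~ alg_indep_on (secant_variety K a b) f.
Proof.
pose T : finType := (bool * option (coord_index b))%type.
have cardT : #|{: T}| = (2 * (\sum_i tnth b i).+1)%N.
  by rewrite card_prod card_bool card_option card_coord_index.
rewrite -cardT => ltTm'.
pose x (t : T) : {mpoly K[#|{: T}|]} := 'X_(enum_rank t).
pose c d := sv_chart origin (fun p => x (d, Some p)).
pose phi := chord (a := a) (x (false, None)) (x (true, None)) (c false) (c true).
apply: (param_alg_dependent (phi := phi) ltTm') => P P0.
apply: (secant_variety_vanishing (base := origin)) => s t w w'.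
pose rho (y : T) : K :=
  match y with
  | (false, None) => s | (true, None) => t
  | (false, Some p) => w p | (true, Some p) => w' p
  end.
rewrite -[RHS](P0 (rho \o enum_val)); apply: meval_eq => l.
rewrite rmorph_chord /= !mevalXU /= !enum_rankK /=.
by apply: eq_chord => i; rewrite rmorph_sv_chart; apply: eq_sv_chart => p;
   rewrite /= mevalXU /= enum_rankK.
Qed.

(** Turns a monomial of small degree into an explicit product of variables. *)
Lemma prod_exp_seq (I : finType) (e : I -> nat) :
  exists2 s : seq I, size s = (\sum_i e i)%N &
    forall (A : comNzRingType) (u : I -> A), \prod_i u i ^+ e i = \prod_(i <- s) u i.
Proof.
exists (flatten [seq nseq (e i) i | i <- enum I]) => [|A u].
  rewrite size_flatten /shape -map_comp sumnE big_map big_enum /=.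
  by under eq_bigr do rewrite size_nseq.
rewrite big_flatten big_map big_enum; apply: eq_bigr => i _.
by rewrite big_nseq iter_mulr_1.
Qed.

(** Monomials of degree at most two only see the mean and the covariance of the
    distribution with mass s at [w] and t at [w'].  The points mu + r d and mu - r d,
    with mu the mean, d = w' - w and r ^ 2 = s t / (s + t) ^ 2, have the same mean
    and covariance when both receive mass (s + t) / 2. *)
Lemma chord_balance (K : numClosedFieldType) (s t : K) (w w' : coord_index b -> K) :
  (\sum_i tnth a i <= 2)%N -> s + t != 0 ->
  exists v v', chord (a := a) s t (sv_chart origin w) (sv_chart origin w') =1
    chord ((s + t) / 2) ((s + t) / 2) (sv_chart origin v) (sv_chart origin v').
Proof.
move=> a2 st0; pose r := sqrtC (s * t) / (s + t).
have r2 : r ^+ 2 = s * t / (s + t) ^+ 2 by rewrite exprMn exprVn sqrtCK.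
pose mix (e : K) (x y : K) := (s * x + t * y) / (s + t) + e * (y - x).
have mixE e : sv_chart origin (fun p => mix e (w p) (w' p)) =1
    fun i => mix e (sv_chart origin w i) (sv_chart origin w' i).
  move=> i; rewrite /sv_chart; case: unlift => //=.
  by rewrite /mix; field.
(* mu + r d and mu - r d; the chart coordinates equal to 1 are preserved *)
exists (fun p => mix r (w p) (w' p)), (fun p => mix (- r) (w p) (w' p)) => l.
rewrite (eq_chord _ _ (mixE _) (mixE _)) /chord /sv_coord.
move: (sv_chart _ w) (sv_chart _ w') => u v.
have [q sz_q prodE] := prod_exp_seq (fun i => val (enum_val l) i : nat).
rewrite !prodE; have {prodE sz_q} : (size q <= 2)%N.
  rewrite sz_q big_tagged (leq_trans _ a2) //; apply: leq_sum => i _.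
  by rewrite (sv_monomialP (enum_val l) i).
case: q => [|i [|j []]] //= _; rewrite ?big_cons !big_nil ?mulr1 /mix.
- by field.
- by field.
move: (u i) (u j) (v i) (v j) => x x' y y'.
transitivity ((s + t) * ((s * x + t * y) / (s + t) * ((s * x' + t * y') / (s + t))
   + r ^+ 2 * ((y - x) * (y' - x')))); last by field.
by rewrite r2; field.
Qed.

(** By [chord_balance] the two scalars may be taken equal, which saves a parameter. *)
Lemma defective_secant_dependent (K : numClosedFieldType) m' :
  (\sum_i tnth a i <= 2)%N -> (2 * (\sum_i tnth b i) + 1 < m')%N ->
  forall f : 'I_m' -> {mpoly K[#|sv_monomial a b|]},
    ~ alg_indep_on (secant_variety K a b) f.
Proof.
move=> a2.
pose T : finType := option (bool * coord_index b).
have cardT : #|{: T}| = (2 * (\sum_i tnth b i) + 1)%N.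
  by rewrite card_option card_prod card_bool card_coord_index addn1.
rewrite -cardT => ltTm'.
pose x (t : T) : {mpoly K[#|{: T}|]} := 'X_(enum_rank t).
pose c d := sv_chart origin (fun p => x (Some (d, p))).
pose phi := chord (a := a) (x None) (x None) (c false) (c true).
apply: (param_alg_dependent (phi := phi) ltTm') => P P0.
apply: (secant_variety_vanishing (base := origin)) => s t w w'.
have P_balanced s' : s' + t != 0 ->
    P.@[chord s' t (sv_chart origin w) (sv_chart origin w')] = 0.
  move=> s't0; have [v [v' chordE]] := chord_balance w w' a2 s't0.
  rewrite (meval_eq _ chordE).
  pose rho (y : T) : K :=
    match y with
    | None => (s' + t) / 2
    | Some (false, p) => v p | Some (true, p) => v' p
    end.
  rewrite -[RHS](P0 (rho \o enum_val)); apply: meval_eq => l.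
  rewrite rmorph_chord /= !mevalXU /= !enum_rankK /=.
  by apply: eq_chord => i; rewrite rmorph_sv_chart; apply: eq_sv_chart => p;
     rewrite /= mevalXU /= enum_rankK.
pose C w := sv_chart origin (fun p => (w p)%:P : {poly K}).
have hornerC_chart v i x0 : (C v i).[x0] = sv_chart origin v i.
  by rewrite /C /sv_chart; case: unlift => [j|] /=; rewrite hornerC.
pose Z := chord (a := a) 'X t%:P (C w) (C w').
have ZE x0 l : (Z l).[x0] = chord x0 t (sv_chart origin w) (sv_chart origin w') l.
  by rewrite horner_chord hornerX hornerC; apply: eq_chord => i; rewrite hornerC_chart.
rewrite -(meval_eq _ (ZE s)); apply: (@meval_curve_eq0 _ _ _ _ ('X + t%:P)).
  by rewrite monic_neq0 // monicXaddC.
move=> x0; rewrite /root !hornerE => /P_balanced P_x0.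
by rewrite -[RHS]P_x0; apply: meval_eq => l; rewrite ZE.
Qed.

End SecantUpperBounds.

(** * Expected dimension of the secant variety *)

Section ChartWeights.
Variables (k : nat) (a b : k.-tuple nat).
Variable (w : coord_index b -> nat).

(** The exponents of the point of the chart all of whose coordinates are powers of one
    variable. *)
Definition chart_weight (base : forall i : 'I_k, 'I_(tnth b i).+1) (t : hcoord_index b) : nat :=
  oapp (fun j => w (ij j)) 0%N (unlift (base (tag t)) (tagged t)).

Lemma sv_chart_powers (A : comNzRingType) (x : A) base t :
  sv_chart base (fun p => x ^+ w p) t = x ^+ chart_weight base t.
Proof. by rewrite /sv_chart /chart_weight; case: unlift. Qed.

Lemma sv_coord_powers (A : comNzRingType) (x : A) base (e : sv_monomial a b) :
  sv_coord (sv_chart base (fun p => x ^+ w p)) e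
    = x ^+ (\sum_t val e t * chart_weight base t).
Proof.
rewrite /sv_coord (big_morph (fun n => x ^+ n) (@exprD _ x) (expr0 _)).
by apply: eq_bigr => t _; rewrite sv_chart_powers -exprM mulnC.
Qed.

Lemma chart_weight_base base i (j : 'I_(tnth b i).+1) :
  j = base i -> chart_weight base (hij j) = 0%N.
Proof. by move=> ->; rewrite /chart_weight /= unlift_none. Qed.

End ChartWeights.

Section NearMonomials.
Variables (k : nat) (a b : k.-tuple nat).
Hypothesis a_gt0 : forall i : 'I_k, (0 < tnth a i)%N.
Variable base : forall i : 'I_k, 'I_(tnth b i).+1.

Definition moved (p : coord_index b) : hcoord_index b :=
  hij (lift (base (tag p)) (tagged p)).

Definition is_moved (o : option (coord_index b)) (t : hcoord_index b) : nat :=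
  if o is Some p then t == moved p else 0%N.

(** For [None], the monomial prod_i x_{i, base i} ^ a_i, which is nonzero only at the
    base point among the torus-fixed points; for [Some p], one factor of block
    [tag p] is replaced by the variable [moved p]. *)
Definition near_base (o : option (coord_index b)) (t : hcoord_index b) : nat :=
  (is_moved o t +
   (if tagged t == base (tag t)
    then tnth a (tag t) - (if o is Some p then tag p == tag t else 0) else 0))%N.

Lemma near_base_block o i : (\sum_(j < (tnth b i).+1) near_base o (hij j) = tnth a i)%N.
Proof.
rewrite big_split /= -big_mkcond /= big_pred1_eq.
case: o => [p|] /=; last by rewrite big1 // subn0.
have -> : (\sum_(j < (tnth b i).+1) (hij j == moved p) = (tag p == i))%N.
  case: p => i' j' /=; rewrite /moved /=; case: eqVneq => [ii'|ni].
    subst i'; rewrite (bigD1 (lift (base i) j')) //= eqxx big1 // => j nj.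
    by rewrite eq_Tagged /= (negPf nj).
  by rewrite big1 // => j _; case: eqP => // /(congr1 tag) /= ii'; rewrite ii' eqxx in ni.
by have := a_gt0 i; case: (tag p == i) => /=; lia.
Qed.

Lemma near_monomial o :
  exists e : sv_monomial a b, forall t, (val e t : nat) = near_base o t.
Proof.
have near_le t : (near_base o t < (\sum_i tnth a i).+1)%N.
  case: t => i j; rewrite ltnS (bigD1 i) //= -[X in (_ <= X + _)%N](near_base_block o i).
  by rewrite (bigD1 j) //= -addnA leq_addr.
have e_in : [forall i, \sum_(j < (tnth b i).+1)
    [ffun t => Ordinal (near_le t)] (hij j) == tnth a i]%N.
  apply/forallP => i; rewrite -[X in _ == X](near_base_block o i).
  by apply/eqP/eq_bigr => j _; rewrite ffunE.
by exists (exist _ [ffun t => Ordinal (near_le t)] e_in) => t; rewrite /= ffunE.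
Qed.

Variable w : coord_index b -> nat.

(** Base variables have weight zero, so only the replaced factor counts. *)
Lemma near_weight o :
  (\sum_t near_base o t * chart_weight w base t)%N = oapp w 0%N o.
Proof.
under eq_bigr => t _.
  rewrite mulnDl; have -> : ((if tagged t == base (tag t)
    then tnth a (tag t) - (if o is Some p then tag p == tag t else 0) else 0) *
    chart_weight w base t = 0)%N.
    by case: t => i j /=; case: eqP => [jb|//]; rewrite -/(hij j) (chart_weight_base w jb) muln0.
  rewrite addn0; over.
case: o => [p|] /=; last by rewrite big1.
rewrite (bigD1 (moved p)) //= eqxx mul1n big1 ?addn0 => [|t /negPf -> //].
by rewrite /chart_weight /= liftK; case: p.
Qed.

(** At most one of the sum a_i >= 3 factors of the monomial is a base variable for
    [base']; each of the others contributes at least [h]. *)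
Lemma far_weight (base' : forall i : 'I_k, 'I_(tnth b i).+1) h o :
  (forall i, base' i != base i) -> (3 <= \sum_i tnth a i)%N ->
  (forall p, h <= w p)%N ->
  (2 * h <= \sum_t near_base o t * chart_weight w base' t)%N.
Proof.
move=> bases a3 w_ge.
have weight_ge i : (tnth a i * h <= \sum_(j < (tnth b i).+1)
    near_base o (hij j) * chart_weight w base' (hij j)
    + is_moved o (hij (base' i)) * h)%N.
  rewrite -{1}(near_base_block o i) big_distrl /= (bigD1 (base' i)) //= addnC.
  apply: leq_add.
    rewrite [leqRHS](bigD1 (base' i)) //= (leq_trans _ (leq_addl _ _)) //.
    apply: leq_sum => j nj; rewrite leq_mul2l /chart_weight /=; apply/orP; right.
    by have [j' _|eqj] := unliftP (base' i) j; [rewrite w_ge|rewrite eqj eqxx in nj].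
  by rewrite /near_base /= (negPf (bases i)) addn0.
have moved_le1 : (\sum_i is_moved o (hij (base' i)) <= 1)%N.
  case: o {weight_ge} => [p|] /=; last by rewrite big1.
  rewrite (bigD1 (tag p)) //= big1 => [|i ni]; first by rewrite addn0 leq_b1.
  by case: eqP => // /(congr1 tag) /= ip; rewrite ip eqxx in ni.
have := leq_sum (index_enum _) (fun i (_ : true) => weight_ge i).
rewrite -big_distrl big_split /= -big_distrl /= [X in _ -> (_ <= X)%N]big_tagged.
move: moved_le1 a3; move: (\sum_i is_moved _ _)%N (\sum_i tnth a i)%N.
by move: (\sum_i \sum_j _)%N => s m A; nia.
Qed.

End NearMonomials.

Section SecantLowerBound.
Variables (k : nat) (a b : k.-tuple nat).
Hypothesis a_gt0 : forall i : 'I_k, (0 < tnth a i)%N.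
Hypothesis b_gt0 : forall i : 'I_k, (0 < tnth b i)%N.

Definition far_point (i : 'I_k) : 'I_(tnth b i).+1 := ord_max.

Lemma secant_linesW (K : numFieldType) z :
  secant_lines (segre_veronese K a b) z -> secant_variety K a b z.
Proof. by move=> Sz; split=> [|d p _ /(_ z)]; [case: Sz | apply]. Qed.

Lemma chord_secant_lines (K : numFieldType) base base'
    (w w' : coord_index b -> K) (s t : K) :
  let x := sv_coord (a := a) (sv_chart base w) in
  let y := sv_coord (sv_chart base' w') in
  s != 0 -> t != 0 -> (forall c, exists e, y e != c * x e) ->
  secant_lines (segre_veronese K a b)
    (\row_l chord s t (sv_chart base w) (sv_chart base' w') l).
Proof.
move=> x y s0 t0 xy.
have chart_in base0 w0 : segre_veronese K a b
    (sv_map a [ffun i => sv_chart base0 w0 i]).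
  exists [ffun i => sv_chart base0 w0 i], 1; split; rewrite ?oner_eq0 ?scale1r // => i.
  by exists (base0 i); rewrite ffunE sv_chart_base oner_eq0.
have chartE base0 w0 l : sv_map a [ffun i => sv_chart base0 w0 i] 0 l
    = sv_coord (sv_chart base0 w0) (enum_val l).
  by rewrite mxE; apply: eq_bigr => i _; rewrite ffunE.
split.
  have [e] := xy (- s / t); apply: contraNneq => /rowP/(_ (enum_rank e)).
  rewrite !mxE /chord enum_rankK -/(x e) -/(y e) => h.
  have -> : y e = (s * x e + t * y e) / t + - s / t * x e by field.
  by rewrite h mul0r add0r.
exists (sv_map a [ffun i => sv_chart base w i]),
  (sv_map a [ffun i => sv_chart base' w' i]), s, t; split=> //.
  move=> c /rowP eq_c; have [e /eqP] := xy c; apply.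
  by have := eq_c (enum_rank e); rewrite [in RHS]mxE !chartE enum_rankK.
by apply/rowP => l; rewrite !mxE; congr (_ * _ + _ * _); apply: eq_bigr => i _; rewrite ffunE.
Qed.

(** The endpoints of the chord stay in the charts around [origin] and [far_point], with
    all chart coordinates and both scalars powers of X.  The coordinate of a
    monomial near one of the two points is then a power of X of prescribed
    exponent, plus a contribution of the other endpoint, which has a larger
    exponent by [far_weight]. *)
Lemma secant_variety_independent (K : numFieldType) m :
  (3 <= \sum_i tnth a i)%N -> m = (2 * (\sum_i tnth b i).+1)%N ->
  exists f : 'I_m -> {mpoly K[#|sv_monomial a b|]},
    alg_indep_on (secant_variety K a b) f.
Proof.
move=> a3.
pose T : finType := (bool * option (coord_index b))%type.
have <- : #|{: T}| = (2 * (\sum_i tnth b i).+1)%N.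
  by rewrite card_prod card_bool card_option card_coord_index.
move=> ->; pose base (d : bool) := if d then far_point else @origin k b.
have bases d i : base (~~ d) i != base d i.
  rewrite -(inj_eq val_inj); have := b_gt0 i.
  by case: d => /=; rewrite ?[0%N == _]eq_sym -lt0n.
have [E EP] : exists E : bool -> option (coord_index b) -> sv_monomial a b,
    forall d o t, (val (E d o) t : nat) = near_base a (base d) o t.
  have ex_E d o := near_monomial a_gt0 (base d) o.
  by exists (fun d o => projT1 (cid (ex_E d o))) => d o; case: (cid (ex_E d o)).
exists (fun j => 'X_(enum_rank (E (enum_val j).1 (enum_val j).2))) => g gY.
(* The scalars s and t get exponents near 4L, and their products with the chart
   coordinates, which are the leading terms for [Some p], exponents near 8L. *)
pose c (x : T) := if x.2 is None then 1%N else 2%N.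
have [L [W [L0 W_bounds W_inj]]] := separating_weights g (fun j => c (enum_val j)).
pose wt (d : bool) (o : option (coord_index b)) : nat := W (enum_rank ((d, o) : T)).
have wt_bounds d o : (c (d, o) * (4 * L) <= wt d o <= c (d, o) * (4 * L) + L)%N.
  by have := W_bounds (enum_rank ((d, o) : T)); rewrite enum_rankK.
have wtN (d : bool) : (4 * L <= wt d None <= 5 * L)%N.
  by have := wt_bounds d None; rewrite /c; move: (wt d None) => W0 /=; lia.
have wtS (d : bool) p : (8 * L <= wt d (Some p) <= 9 * L)%N.
  by have := wt_bounds d (Some p); rewrite /c; move: (wt d (Some p)) => W0 /=; lia.
pose w d p := (wt d (Some p) - wt d None)%N.
have w_ge d p : (3 * L <= w d p)%N.
  by rewrite /w; have := wtS d p; have := wtN d; lia.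
pose cw d := chart_weight (w d) (base d).
(* The exponent of X in the monomial E d' o at the endpoint in the chart base d. *)
pose ex (d d' : bool) o := (\sum_t val (E d' o) t * cw d t)%N.
have ex_near d o : (wt d None + ex d d o = wt d o)%N.
  have -> : ex d d o = oapp (w d) 0%N o.
    by rewrite -(near_weight a (base d)); apply: eq_bigr => t _; rewrite EP.
  case: o => [p|]; rewrite [oapp _ _ _]/=; last by rewrite addn0.
  by rewrite /w; have := wtS d p; have := wtN d; lia.
have ex_far d o : (6 * L <= ex (~~ d) d o)%N.
  have := far_weight a_gt0 o (bases d) a3 (w_ge (~~ d)).
  rewrite (eq_bigr (fun t => val (E d o) t * cw (~~ d) t)%N); last first.
    by move=> t _; rewrite EP.
  by rewrite -/(ex _ _ _); lia.
pose far d o := (wt (~~ d) None + ex (~~ d) d o)%N.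
have far_lt d o : (wt d o < far d o)%N.
  have := ex_far d o; have := wtN (~~ d); rewrite /far.
  by case: o => [p|]; [have := wtS d p | have := wtN d]; lia.
pose point (A : comNzRingType) (x : A) d := sv_chart (base d) (fun p => x ^+ w d p).
pose Z (A : comNzRingType) (x : A) := chord (a := a)
  (x ^+ wt false None) (x ^+ wt true None) (point A x false) (point A x true).
have ZE (A : comNzRingType) (x : A) d o :
    Z A x (enum_rank (E d o)) = x ^+ wt d o + x ^+ far d o.
  rewrite /Z /chord enum_rankK !sv_coord_powers -!exprD -/(ex false d o) -/(ex true d o).
  by case: d; rewrite /far ex_near // addrC.
have gZ : mmap (@polyC K) (fun j =>
    Z _ 'X (enum_rank (E (enum_val j).1 (enum_val j).2))) g = 0.
  (* The endpoints of the chord can only be proportional where X ^+ n = 1. *)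
  pose n := (ex true false None + ex false true None)%N.
  have n0 : (0 < n)%N by have := ex_far true None; rewrite /n /=; lia.
  apply: (@poly_eq0_offroots _ _ ('X * ('X^n - 1))).
    by rewrite mulf_neq0 ?polyX_eq0 // monic_neq0 // monicXnsubC.
  move=> x; rewrite rootM rootX negb_or => /andP[x0].
  rewrite /root !hornerE subr_eq0 => xn.
  rewrite horner_mmap.
  have Sx : secant_variety K a b (\row_l Z _ x l).
    apply/secant_linesW/chord_secant_lines; rewrite ?expf_neq0 // => c1.
    have powE d d' o : sv_coord (point _ x d) (E d' o) = x ^+ ex d d' o.
      exact: sv_coord_powers.
    have ex0 d : ex d d None = 0%N by have := ex_near d None; lia.
    have [yc|] := eqVneq (x ^+ ex true false None) c1; last first.
      by exists (E false None); rewrite !powE ex0 mulr1.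
    by exists (E true None); rewrite !powE ex0 -yc -exprD eq_sym.
  rewrite -[RHS](gY _ Sx); apply: meval_eq => j.
  by rewrite mevalXU mxE !ZE !hornerE.
pose r (j : 'I_#|T|) : {poly K} :=
  'X^((far (enum_val j).1 (enum_val j).2 - wt (enum_val j).1 (enum_val j).2).-1).
apply: (leading_exponents (r := r) W_inj); rewrite -[RHS]gZ.
congr (mmap _ _ _); apply/funext => j; rewrite ZE.
have := far_lt (enum_val j).1 (enum_val j).2.
have -> : W j = wt (enum_val j).1 (enum_val j).2.
  by rewrite /wt -surjective_pairing enum_valK.
rewrite /r mulrDr mulr1 -exprS -exprD; move: (wt _ _) (far _ _) => x y ltxy.
by congr ('X^_ + 'X^_); lia.
Qed.

End SecantLowerBound.

(** * Affine hulls and convex hulls *)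

Section AffineGeometry.
Variables (R : realType) (V : vectType R).
Implicit Types (S : set V) (v x y : V).

(** The affine hull is the case c = 1, and its directions are the case c = 0. *)
Definition weighted_comb S (c : R) v : Prop :=
  exists m (y : 'I_m -> V) (t : 'I_m -> R),
    [/\ forall l, S (y l), \sum_l t l = c & v = \sum_l t l *: y l].

Lemma weighted_comb_mem S x : S x -> weighted_comb S 1 x.
Proof.
by move=> Sx; exists 1%N, (fun _ => x), (fun _ => 1); split=> //; rewrite big_ord1 ?scale1r.
Qed.

Lemma weighted_combD S c d v w :
  weighted_comb S c v -> weighted_comb S d w -> weighted_comb S (c + d) (v + w).
Proof.
move=> [m [y [t [Sy <- ->]]]] [m' [y' [t' [Sy' <- ->]]]].
exists (m + m')%N,
  (fun l => match split l with inl i => y i | inr i => y' i end),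
  (fun l => match split l with inl i => t i | inr i => t' i end); split.
- by move=> l; case: split.
- by rewrite big_split_ord; congr (_ + _); apply: eq_bigr => l _;
    rewrite ?(unsplitK (inl l)) ?(unsplitK (inr l)).
by rewrite big_split_ord; congr (_ + _); apply: eq_bigr => l _;
  rewrite ?(unsplitK (inl l)) ?(unsplitK (inr l)).
Qed.

Lemma weighted_combZ S c d v : weighted_comb S c v -> weighted_comb S (d * c) (d *: v).
Proof.
move=> [m [y [t [Sy <- ->]]]]; exists m, y, (fun l => d * t l).
by rewrite mulr_sumr scaler_sumr; split=> //; apply: eq_bigr => l _; rewrite scalerA.
Qed.

Lemma direction_sub S x y :
  weighted_comb S 1 x -> weighted_comb S 1 y -> weighted_comb S 0 (x - y).
Proof.
move=> Sx Sy; rewrite -scaleN1r -(addrN 1) -[X in _ - X]mul1r -mulNr.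
exact/weighted_combD/weighted_combZ.
Qed.

Lemma direction_sum S (I : finType) (c : I -> R) (v : I -> V) :
  (forall i, weighted_comb S 0 (v i)) -> weighted_comb S 0 (\sum_i c i *: v i).
Proof.
move=> Sv; elim/big_ind: _ => [|x y Sx Sy|i _].
- by exists 0%N, (fun=> 0), (fun=> 0); rewrite !big_ord0; split=> // -[].
- by rewrite -(addr0 0); exact: weighted_combD.
by rewrite -(mulr0 (c i)); exact: weighted_combZ.
Qed.

Lemma linear_weighted_comb S (f : {linear V -> R^o}) c d v :
  (forall x, S x -> f x = c) -> weighted_comb S d v -> f v = d * c.
Proof.
move=> fS [m [y [t [Sy <- ->]]]]; rewrite linear_sum mulr_suml.
by apply: eq_bigr => l _; rewrite linearZ /= fS.
Qed.

Lemma affine_dim_intro S (U : {vspace V}) p :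
  S p -> (forall x, S x -> x - p \in U) ->
  (forall v, v \in U -> weighted_comb S 0 v) -> affine_dim S (\dim U)%:Z.
Proof.
move=> Sp SU US; right; exists p, U; split=> //; apply/seteqP; split=> x.
  move=> [m [y [t [Sy t1 ->]]]]; exists (\sum_l t l *: y l - p); last by rewrite addrC subrK.
  rewrite /= -[X in _ - X]scale1r -t1 scaler_suml -sumrB; apply: rpred_sum => l _.
  by rewrite -scalerBr rpredZ // SU.
case=> u Uu <-; have := weighted_combD (weighted_comb_mem Sp) (US _ Uu).
by rewrite addr0.
Qed.

Lemma affine_dim_fullP S p (d : int) :
  S p -> (forall v, weighted_comb S 0 v) ->
  affine_dim S d <-> d = (\dim {:V})%:Z.
Proof.
move=> Sp Sdir; split=> [|->]; last first.
  by apply: (@affine_dim_intro _ fullv p) => // x; rewrite memvf.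
case=> [[S0]|]; first by rewrite S0 in Sp.
move=> [p' [U [hullE ->]]].
suff -> : U = fullv by [].
apply/eqP; rewrite eqEsubv subvf; apply/subvP => v _.
have p'_hull : affine_hull S p' by rewrite hullE; exists 0; rewrite /= ?mem0v ?addr0.
have : affine_hull S (p' + v).
  by have := weighted_combD p'_hull (Sdir v); rewrite addr0.
by rewrite hullE => -[u Uu /addrI <-].
Qed.

Variable f : {linear V -> R^o}.
Hypothesis f_neq0 : exists v, f v != 0.

Lemma dim_kernel : \dim (lker (linfun f)) = (\dim {:V}).-1.
Proof.
have := limg_ker_dim (linfun f) fullv; rewrite capfv => <-.
suff -> : \dim (linfun f @: fullv) = 1%N by rewrite addn1.
apply/eqP; rewrite eqn_leq (leq_trans (dimvS (subvf _))) ?dimvf //=.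
have [v fv] := f_neq0.
rewrite lt0n dimv_eq0; apply: contraNneq fv => img0.
by have := memv_img (linfun f) (memvf v); rewrite img0 memv0 lfunE.
Qed.

Lemma dim_gt0 : (0 < \dim {:V})%N.
Proof.
rewrite lt0n dimv_eq0; have [v] := f_neq0; apply: contraNneq => V0.
by have := memvf v; rewrite V0 memv0 => /eqP ->; rewrite linear0.
Qed.

Lemma affine_dim_hyperplane S p c :
  S p -> (forall x, S x -> f x = c) ->
  (forall v, f v = 0 -> weighted_comb S 0 v) ->
  affine_dim S ((\dim {:V})%:Z - 1).
Proof.
move=> Sp fS Sdir.
have -> : (\dim {:V})%:Z - 1 = (\dim (lker (linfun f)))%:Z.
  by rewrite dim_kernel -subn1 -subzn // dim_gt0.
apply: (@affine_dim_intro _ _ p) => // x; rewrite memv_ker lfunE /=.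
  by move=> Sx; rewrite linearB !fS ?subrr.
by move/eqP/Sdir.
Qed.

Lemma hyperplane_not_full S c :
  (forall x, S x -> f x = c) -> ~ affine_dim S (\dim {:V})%:Z.
Proof.
move=> fS [[_ dimV]|[p [U [hullE /eqP]]]]; first by lia.
rewrite eqz_nat => /eqP dimU.
have U_full : U = fullv by apply/eqP; rewrite eqEdim subvf dimU leqnn.
have fc v : f (p + v) = c.
  rewrite -[RHS]mul1r; apply: (linear_weighted_comb fS).
  suff: affine_hull S (p + v) by [].
  by rewrite hullE; exists v => //=; rewrite U_full memvf.
have [v /negP[]] := f_neq0; have := fc v; rewrite linearD.
have := fc 0; rewrite addr0 => -> cfv.
by rewrite -[f v](addKr c) cfv addNr.
Qed.

(** In dimension dim V - 1 the set would span the hyperplane f = 0, which contains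
    the origin, where [g] does not take the value [c]. *)
Lemma codim2_not_facet_dim S (g : {linear V -> R^o}) c :
  (forall x, S x -> f x = 0) -> (forall x, S x -> g x = c) -> c != 0 ->
  ~ affine_dim S ((\dim {:V})%:Z - 1).
Proof.
move=> fS gS c0 [[_ dimV]|[p [U [hullE]]]]; first by have := dim_gt0; lia.
have -> : (\dim {:V})%:Z - 1 = (\dim (lker (linfun f)))%:Z.
  by rewrite dim_kernel -subn1 -subzn // dim_gt0.
move/eqP; rewrite eqz_nat => /eqP dimU.
have f0 u : u \in U -> f (p + u) = 0.
  move=> Uu; rewrite -[RHS](mul1r 0); apply: (linear_weighted_comb fS).
  suff: affine_hull S (p + u) by [].
  by rewrite hullE; exists u.
have fp : f p = 0 by rewrite -(addr0 p) f0 // mem0v.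
have U_ker : U = lker (linfun f).
  apply/eqP; rewrite eqEdim dimU leqnn andbT; apply/subvP => u /f0.
  by rewrite linearD fp add0r memv_ker lfunE /= => ->.
have : affine_hull S 0.
  by rewrite hullE; exists (- p); rewrite ?subrr //= rpredN U_ker memv_ker lfunE /= fp.
move/(linear_weighted_comb gS); rewrite linear0 mul1r => /esym/eqP.
by rewrite (negPf c0).
Qed.

End AffineGeometry.

Section ConvexHull.
Variables (R : realType) (V : vectType R).

Lemma conv_hull_mem (S : set V) x : S x -> conv_hull S x.
Proof.
move=> Sx; exists 1%N, (fun _ => x), (fun _ => 1).
by split=> //; rewrite big_ord1 ?scale1r.
Qed.

Lemma conv_hull_le (S : set V) (f : {linear V -> R^o}) (c : R) :
  (forall x, S x -> f x <= c) -> forall x, conv_hull S x -> f x <= c.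
Proof.
move=> fS x [m [y [t [Sy t0 t1 ->]]]]; rewrite linear_sum -[c]mul1r -t1 mulr_suml.
by apply: ler_sum => l _; rewrite linearZ ler_wpM2l // fS.
Qed.

End ConvexHull.

(** * Lattice points of the polytope *)

Section Polytope.
Variables (R : realType) (k : nat) (a b : k.-tuple nat).
Hypothesis b_gt0 : forall i : 'I_k, (0 < tnth b i)%N.
Local Notation coord := (coord_index b).
Local Notation V := {ffun coord -> R^o}.
Implicit Types (s : seq coord) (p q t : coord) (A : pred coord).

Lemma dim_coord_space : \dim {:V} = (\sum_i tnth b i)%N.
Proof.
by rewrite dimvf /dim /= muln1 card_coord_index.
Qed.

Definition weighted_sum (al : coord -> R) (x : V) : R^o := \sum_t al t * x t.

Lemma weighted_sum_is_linear al : linear (weighted_sum al).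
Proof.
move=> c x y; rewrite /weighted_sum scaler_sumr -big_split; apply: eq_bigr => t _.
by rewrite !ffunE mulrDr /GRing.scale /= mulrCA.
Qed.

HB.instance Definition _ al :=
  GRing.isLinear.Build R V R^o _ (weighted_sum al) (weighted_sum_is_linear al).

Definition indic A t : R := (A t)%:R.

Lemma weighted_sum_indic A (x : V) : weighted_sum (indic A) x = \sum_(t | A t) x t.
Proof.
rewrite [RHS]big_mkcond; apply: eq_bigr => t _; rewrite /indic.
by case: (A t); rewrite ?mul1r ?mul0r.
Qed.

Lemma weighted_sumN al (x : V) : weighted_sum (fun t => - al t) x = - weighted_sum al x.
Proof. by rewrite -sumrN; apply: eq_bigr => t _; rewrite mulNr. Qed.

(** Lattice points are handled as lists of coordinates, counted with multiplicity:
    adding a unit vector is then adding an entry. *)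
Definition legal s := forall i : 'I_k, (count (fun p => tag p == i) s <= tnth a i)%N.

Definition point s : V := [ffun t => (count_mem t s)%:R].

Definition unit_vec p : V := [ffun t => (t == p)%:R].

Lemma sum_count_mem A s : (\sum_(t | A t) count_mem t s = count A s)%N.
Proof.
elim: s => [|p s IH] /=; first by rewrite big1.
rewrite big_split /= IH; congr (_ + _)%N.
rewrite big_mkcond (bigD1 p) //= eqxx big1 ?addn0 => [|t ntp].
  by case: (A p).
by rewrite eq_sym (negPf ntp); case: (A t).
Qed.

Lemma weighted_sum_point A s : weighted_sum (indic A) (point s) = (count A s)%:R.
Proof.
rewrite weighted_sum_indic -sum_count_mem natr_sum.
by apply: eq_bigr => t _; rewrite ffunE.
Qed.

Lemma weighted_sum_unit al p : weighted_sum al (unit_vec p) = al p.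
Proof.
rewrite /weighted_sum (bigD1 p) //= big1 ?addr0 ?ffunE ?eqxx ?mulr1 // => t ntp.
by rewrite ffunE (negPf ntp) mulr0.
Qed.

Lemma point_cons p s : point (p :: s) - point s = unit_vec p.
Proof.
by apply/ffunP => t; rewrite !ffunE /= natrD addrK eq_sym.
Qed.

Lemma block_sum (M : nmodType) (F : coord -> M) i :
  \sum_(t | tag t == i) F t = \sum_(j < tnth b i) F (ij j).
Proof.
rewrite big_mkcond big_tagged (bigD1 i) //= eqxx [X in _ + X]big1 ?addr0 // => i' ni.
by rewrite big1 // => j _; rewrite (negPf ni).
Qed.

Lemma block_sumn (F : coord -> nat) i :
  (\sum_(t | tag t == i) F t = \sum_(j < tnth b i) F (ij j))%N.
Proof. exact: (block_sum (M := nat)). Qed.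

Lemma point_in_P s : legal s -> (2 <= size s)%N -> polytopeP R a b (point s).
Proof.
move=> s_legal s2; apply: conv_hull_mem; exists [ffun t => count_mem t s]; split.
- move=> i; under eq_bigr do rewrite ffunE.
  by rewrite -(block_sumn (fun t => count_mem t s)) sum_count_mem.
- under eq_bigr do rewrite ffunE.
  by rewrite (sum_count_mem predT) count_predT.
- by apply/ffunP => t; rewrite !ffunE.
Qed.

(** The largest size of a legal list with entries in [A]. *)
Definition capacity A := (\sum_(i < k | [exists p : coord, A p && (tag p == i)]) tnth a i)%N.

Lemma size_blocks s : (size s = \sum_i count (fun p => tag p == i) s)%N.
Proof.
elim: s => [|p s IH] /=; first by rewrite big1.
rewrite big_split /= -IH (bigD1 (tag p)) //= eqxx big1 ?add1n // => i ni.
by rewrite eq_sym (negPf ni).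
Qed.

(** A legal list that cannot be extended in [A] fills all blocks that meet [A]. *)
Lemma legal_extend1 A s :
  legal s -> (size s < capacity A)%N -> exists2 q, A q & legal (q :: s).
Proof.
move=> s_legal s_small.
have [q /andP[Aq q_room]|full] := pickP (fun q => A q &&
    (count (fun p => tag p == tag q) s < tnth a (tag q))%N).
  exists q => // i /=; case: eqP => [<-|_]; first by rewrite add1n.
  by rewrite add0n.
suff : (capacity A <= size s)%N by rewrite leqNgt s_small.
rewrite size_blocks [leqLHS]big_mkcond /=; apply: leq_sum => i _.
case: existsP => [[q /andP[Aq /eqP qi]]|//].
by have := full q; rewrite Aq qi /= => /negbT; rewrite -leqNgt.
Qed.

Lemma legal_extend A s N :
  legal s -> all A s -> (size s <= N)%N -> (N <= capacity A)%N ->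
  exists s', [/\ legal (s ++ s'), all A (s ++ s') & size (s ++ s') = N].
Proof.
move=> s_legal As; elim: N => [|N IH] sN Ncap.
  by exists [::]; rewrite cats0; split=> //; apply/eqP; rewrite -leqn0.
move: sN; rewrite leq_eqVlt => /predU1P[sN|]; first by exists [::]; rewrite cats0.
rewrite ltnS => sN; have [s' [leg all' sz]] := IH sN (ltnW Ncap).
have [|q Aq q_leg] := legal_extend1 (A := A) leg; first by rewrite sz.
exists (q :: s'); split=> [i||].
- by have := q_leg i; rewrite !count_cat /= count_cat addnCA.
- by move: all'; rewrite !all_cat /= Aq.
- by rewrite -sz !size_cat addnS.
Qed.

Lemma legal_behead p s : legal (p :: s) -> legal s.
Proof. by move=> leg i; apply: leq_trans (leg i); rewrite leq_addl. Qed.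

Lemma legal_full s i : legal s -> size s = (\sum_i tnth a i)%N ->
  count (fun p => tag p == i) s = tnth a i.
Proof.
move=> leg; rewrite size_blocks => eq_sum.
apply/eqP; rewrite eqn_leq leg leqNgt; apply/negP => lt_i.
suff : (\sum_i count (fun p => tag p == i) s < \sum_i tnth a i)%N by rewrite eq_sum ltnn.
rewrite (bigD1 i) //= [ltnRHS](bigD1 i) //= -addSn; apply: leq_add => //.
by apply: leq_sum => j _; apply: leg.
Qed.

Lemma capacity_full A : (forall i, exists2 p, A p & tag p = i) ->
  capacity A = (\sum_i tnth a i)%N.
Proof.
move=> A_all; apply: eq_bigl => i; apply/existsP.
by have [p Ap pi] := A_all i; exists p; rewrite Ap pi eqxx.
Qed.

Lemma coord_in_block i : exists p : coord, tag p = i.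
Proof. by exists (ij (Ordinal (b_gt0 i))). Qed.

(** The given directions span all vectors whose coordinates in [A] sum to zero. *)
Lemma hyperplane_affine_dim (S : set V) A c x0 p0 :
  S x0 -> A p0 -> (forall x, S x -> \sum_(t | A t) x t = c) ->
  (forall t, ~~ A t -> weighted_comb S 0 (unit_vec t)) ->
  (forall t, A t -> weighted_comb S 0 (unit_vec t - unit_vec p0)) ->
  affine_dim S ((\sum_i tnth b i)%:Z - 1).
Proof.
move=> Sx0 Ap0 SA dir_out dir_in; rewrite -dim_coord_space.
apply: (affine_dim_hyperplane (f := weighted_sum (indic A)) (c := c) _ Sx0).
- by exists (unit_vec p0); rewrite /= weighted_sum_unit /indic Ap0 oner_eq0.
- by move=> x /SA <-; rewrite /= weighted_sum_indic.
move=> v /= v0.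
(* The correction terms sum to a multiple of [weighted_sum (indic A) v = 0]. *)
have -> : v = \sum_t v t *: (unit_vec t - indic A t *: unit_vec p0).
  under eq_bigr => t _ do rewrite scalerBr scalerA mulrC.
  rewrite sumrB -scaler_suml -/(weighted_sum (indic A) v) v0 scale0r subr0.
  apply/ffunP => t; rewrite sum_ffunE (bigD1 t) //= big1 => [|t' nt].
    by rewrite !ffunE eqxx addr0 /GRing.scale /= mulr1.
  by rewrite !ffunE eq_sym (negPf nt) scaler0.
apply: direction_sum => t; rewrite /indic.
case: (boolP (A t)) => [At|nAt]; first by rewrite scale1r; apply: dir_in.
by rewrite scale0r subr0; apply: dir_out.
Qed.

End Polytope.

(** * Dimension of the polytope and its facets *)

Section Facets.
Variables (R : realType) (k : nat) (a b : k.-tuple nat).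
Hypothesis a_gt0 : forall i : 'I_k, (0 < tnth a i)%N.
Hypothesis b_gt0 : forall i : 'I_k, (0 < tnth b i)%N.
Local Notation coord := (coord_index b).
Local Notation V := {ffun coord -> R^o}.
Local Notation P := (polytopeP R a b).
Local Notation sum_a := (\sum_(i < k) tnth a i)%N.
Implicit Types (s : seq coord) (p q t : coord) (A : pred coord).

Lemma P_le al (c : R) :
  (forall e : {ffun coord -> nat},
     (forall i : 'I_k, (\sum_(j < tnth b i) e (ij j) <= tnth a i)%N) ->
     (2 <= \sum_t e t)%N -> \sum_t al t * (e t)%:R <= c) ->
  forall x : V, P x -> weighted_sum al x <= c.
Proof.
move=> le_c; apply: conv_hull_le => x [e [e_a e2 ->]].
by rewrite /= /weighted_sum; under eq_bigr do rewrite ffunE; apply: le_c.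
Qed.

Lemma P_block_le (x : V) i : P x -> \sum_(t | tag t == i) x t <= (tnth a i)%:R.
Proof.
move=> Px; rewrite -(weighted_sum_indic (fun t => tag t == i)).
apply: P_le x Px => e e_a _.
under eq_bigr do rewrite /indic -natrM; rewrite -natr_sum ler_nat.
rewrite (leq_trans _ (e_a i)) // -(block_sumn e) [leqRHS]big_mkcond /=.
by apply: leq_sum => t _; case: (tag t == i); rewrite ?mul1n ?mul0n.
Qed.

Lemma P_sum_ge2 (x : V) : P x -> 2 <= \sum_t x t.
Proof.
move=> Px; rewrite -(weighted_sum_indic predT) -lerN2 -weighted_sumN.
apply: P_le x Px => e _ e2.
under eq_bigr do rewrite /indic mulN1r; rewrite sumrN lerN2 -natr_sum.
by rewrite (ler_nat R 2).
Qed.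

Lemma P_ge0 (x : V) t : P x -> 0 <= x t.
Proof.
move=> Px; have -> : x t = weighted_sum (indic R (pred1 t)) x.
  by rewrite weighted_sum_indic big_pred1_eq.
rewrite -oppr_le0 -weighted_sumN; apply: P_le x Px => e _ _.
by apply: sumr_le0 => t' _; rewrite mulNr oppr_le0 mulr_ge0 ?ler0n.
Qed.

Lemma P_sum_le (x : V) : P x -> \sum_t x t <= sum_a%:R.
Proof.
move=> Px; rewrite big_tagged natr_sum; apply: ler_sum => i _.
by rewrite -(block_sum (fun t => x t)); exact: P_block_le.
Qed.

Lemma P_eq_faceF : (sum_a <= 2)%N -> P = faceF R a b.
Proof.
move=> a2; apply/seteqP; split=> x; last by case.
move=> Px; split=> //; apply/eqP; rewrite eq_le P_sum_ge2 // andbT.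
by rewrite (le_trans (P_sum_le Px)) // (ler_nat R _ 2).
Qed.

Lemma face_intro (Q : set V) al (c : R) :
  (forall x, P x -> weighted_sum al x <= c) ->
  (forall x, Q x <-> P x /\ weighted_sum al x = c) -> face Q P.
Proof.
move=> le_c QE; exists (weighted_sum al), c; split=> //.
by apply/seteqP; split=> x /QE.
Qed.

Lemma legal1 p : legal a [:: p].
Proof. by move=> i; rewrite /= addn0 (leq_trans (leq_b1 _)) // a_gt0. Qed.

(** A legal list of size three through [p] remains in [S] when [p] is removed. *)
Lemma unit_direction A (S : set V) p :
  (3 <= capacity a A)%N -> A p ->
  (forall s, legal a s -> all A s -> (2 <= size s)%N -> S (point R s)) ->
  weighted_comb S 0 (unit_vec R p).
Proof.
move=> cap Ap S_point.
have [||s [leg all_s sz]] := legal_extend (A := A) (legal1 p) _ _ cap.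
- by rewrite /= Ap.
- by [].
rewrite -(point_cons _ p s); move: all_s sz => /= /andP[_ all_s] [sz].
apply: direction_sub; apply: weighted_comb_mem; apply: S_point => //=.
- by rewrite Ap.
- by rewrite sz.
- exact: legal_behead leg.
by rewrite sz.
Qed.

Lemma capacity_all : capacity (b := b) a predT = sum_a.
Proof. by apply: capacity_full => i; have [p pi] := coord_in_block b_gt0 i; exists p. Qed.

Lemma exists_point A (S : set V) :
  (2 <= capacity a A)%N ->
  (forall s, legal a s -> all A s -> size s = 2 -> S (point R s)) -> exists x, S x.
Proof.
move=> cap S_point.
have [//|//|//|s [leg all_s sz]] := legal_extend (A := A) (s := [::]) _ _ _ cap.
by exists (point R s); apply: S_point.
Qed.

Lemma P_directions (v : V) : (3 <= sum_a)%N -> weighted_comb P 0 v.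
Proof.
move=> a3; have -> : v = \sum_t v t *: unit_vec R t.
  apply/ffunP => t; rewrite sum_ffunE (bigD1 t) //= big1 => [|t' nt].
    by rewrite !ffunE eqxx addr0 /GRing.scale /= mulr1.
  by rewrite !ffunE eq_sym (negPf nt) scaler0.
apply: direction_sum => t; apply: (unit_direction (A := predT)) => //.
  by rewrite capacity_all.
by move=> s leg _; apply: point_in_P.
Qed.

Lemma P_nonempty : (3 <= sum_a)%N -> exists x, P x.
Proof.
move=> a3; apply: (exists_point (A := predT)); first by rewrite capacity_all ltnW.
by move=> s leg _ sz; apply: point_in_P; rewrite ?sz.
Qed.

Lemma affine_dim_PE d : (3 <= sum_a)%N ->
  affine_dim P d <-> d = (\sum_i tnth b i)%N.
Proof.
move=> a3; have [x Px] := P_nonempty a3.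
by rewrite (affine_dim_fullP d Px (P_directions^~ a3)) dim_coord_space.
Qed.

Lemma P_not_full : (0 < k)%N -> (sum_a <= 2)%N ->
  ~ affine_dim P (\sum_i tnth b i)%N.
Proof.
move=> k_gt0 a2; rewrite -(dim_coord_space R b).
apply: (hyperplane_not_full (f := weighted_sum (indic R predT)) _ (c := 2)).
  have [p _] := coord_in_block b_gt0 (Ordinal k_gt0).
  by exists (unit_vec R p); rewrite /= weighted_sum_unit oner_eq0.
by move=> x; rewrite P_eq_faceF //= weighted_sum_indic => -[].
Qed.

Lemma facetE (Q : set V) : (3 <= sum_a)%N ->
  facet Q P <-> face Q P /\ affine_dim Q ((\sum_i tnth b i)%:Z - 1).
Proof.
move=> a3; split=> [[fQ [d []]]|[fQ dQ]]; first by move/(affine_dim_PE _ a3)=> ->.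
by split=> //; exists (\sum_i tnth b i)%N; split=> //; apply/affine_dim_PE.
Qed.


(** Any two coordinates [p] and [p0] have a common companion [q] such that both pairs
    are legal: if [p] and [p0] share a block, any companion of [p] will do, and
    otherwise [p] and [p0] complete to a legal triple. *)
Lemma facet_faceF : (3 <= sum_a)%N -> facet (faceF R a b) P.
Proof.
move=> a3; apply/facetE => //.
have inF s : legal a s -> size s = 2 -> faceF R a b (point R s).
  move=> leg sz; split; first by apply: point_in_P; rewrite ?sz.
  by rewrite -(weighted_sum_indic predT) weighted_sum_point count_predT sz.
split.
  apply: (face_intro (al := fun t => - indic R predT t) (c := -2)) => x.
    by move=> Px; rewrite weighted_sumN lerN2 weighted_sum_indic P_sum_ge2.
  rewrite weighted_sumN weighted_sum_indic.
  by split=> [[Px ->]|[Px /oppr_inj]].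
have [x0 Fx0] : exists x, faceF R a b x.
  apply: (exists_point (A := predT)); first by rewrite capacity_all ltnW.
  by move=> s leg _; apply: inF.
have n_gt0 : (0 < \sum_i tnth a i)%N by apply: leq_trans a3.
have [p0 _] : exists p : coord, true.
  have [k0 _] : exists i : 'I_k, true.
    move: n_gt0; case: (k) a => [a0|k' _ _]; first by rewrite big_ord0.
    by exists ord0.
  by have [p _] := coord_in_block b_gt0 k0; exists p.
apply: (hyperplane_affine_dim (A := predT) (p0 := p0) (c := 2) Fx0) => // [x [] //|p _].
have cap N : (N <= sum_a)%N -> (N <= capacity (b := b) a predT)%N by rewrite capacity_all.
suff [q leg leg0] : exists2 q, legal a [:: p; q] & legal a [:: p0; q].
  have -> : unit_vec R p - unit_vec R p0 = point R [:: p; q] - point R [:: p0; q].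
    by rewrite -!(point_cons _ _ [:: q]) opprB addrA addrNK.
  by apply: direction_sub; apply: weighted_comb_mem; apply: inF.
have [same|diff] := eqVneq (tag p) (tag p0).
  have [|q _ leg] := legal_extend1 (A := predT) (legal1 p).
    by apply: cap; apply: leq_trans a3.
  exists q => i; move: (leg i); rewrite /= same;
    by case: (tag q == i) (tag p0 == i) => [] [] /=; lia.
have leg2 : legal a [:: p; p0].
  move=> i; rewrite /= addn0 (leq_trans _ (a_gt0 i)) //.
  by case: eqP => [<-|_]; rewrite ?(negPf diff) ?leq_b1 // eq_sym (negPf diff).
have [|q _ leg] := legal_extend1 (A := predT) leg2; first exact: cap.
exists q => i; move: (leg i) => /=;
  by case: (tag q == i) (tag p == i) (tag p0 == i) => [] [] [] /=; lia.
Qed.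

(** Start from lists that fill all blocks.  Exchanging entries of block [i] or removing
    an entry outside it leaves block [i] full, and the size stays at least two
    because sum a_i >= 3. *)
Lemma facet_faceR i : (3 <= sum_a)%N -> facet (faceR R a b i) P.
Proof.
move=> a3; apply/facetE => //.
pose A p := tag p == i.
have inR s : legal a s -> (2 <= size s)%N -> count A s = tnth a i ->
    faceR R a b i (point R s).
  move=> leg sz full; split; first exact: point_in_P.
  by rewrite -(block_sum (fun t => point R s t)) -weighted_sum_indic weighted_sum_point full.
split.
  apply: (face_intro (al := indic R A) (c := (tnth a i)%:R)) => x.
    by move=> Px; rewrite weighted_sum_indic P_block_le.
  by rewrite weighted_sum_indic (block_sum (fun t => x t)).
have [p0 p0i] := coord_in_block b_gt0 i.
have extend p : exists s, [/\ legal a (p :: s), size s = sum_a.-1 &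
    forall j, count (fun q => tag q == j) (p :: s) = tnth a j].
  have [|||s [leg _ sz]] := legal_extend (A := predT) (N := sum_a) (legal1 p).
  - by [].
  - by apply: leq_trans a3.
  - by rewrite capacity_all.
  exists s; split=> [//||j]; last exact: legal_full.
  by rewrite -sz.
have [s [leg sz full]] := extend p0.
have Rx0 : faceR R a b i (point R (p0 :: s)).
  by apply: inR; [exact: leg|rewrite /= sz; lia|exact: full].
apply: (hyperplane_affine_dim (A := A) (p0 := p0) (c := (tnth a i)%:R) Rx0).
- by rewrite /A p0i.
- by move=> x [_ <-]; rewrite (block_sum (fun t => x t)).
- move=> t nAt; have [s' [leg' sz' full']] := extend t.
  rewrite -(point_cons _ t s').
  apply: direction_sub; apply: weighted_comb_mem; apply: inR.
  + exact: leg'.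
  + by rewrite /= sz'; lia.
  + exact: full'.
  + exact: legal_behead leg'.
  + by rewrite sz'; lia.
  by rewrite -(full' i) /= -/(A t) (negPf nAt).
move=> t /eqP ti.
have -> : unit_vec R t - unit_vec R p0 = point R (t :: s) - point R (p0 :: s).
  by rewrite -!(point_cons _ _ s) opprB addrA addrNK.
apply: direction_sub; apply: weighted_comb_mem => //; apply: inR.
- by move=> j; have := leg j; rewrite /= ti p0i.
- by rewrite /= sz; lia.
by rewrite -(full i) /= /A ti p0i.
Qed.

Lemma faceZ_face i (j : 'I_(tnth b i)) : face (faceZ R a b i j) P.
Proof.
apply: (face_intro (al := fun t => - indic R (pred1 (ij j)) t) (c := 0)) => x.
  by move=> Px; rewrite weighted_sumN weighted_sum_indic big_pred1_eq oppr_le0 P_ge0.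
rewrite weighted_sumN weighted_sum_indic big_pred1_eq.
split=> [[Px ->]|[Px /eqP]]; first by rewrite oppr0.
by rewrite oppr_eq0 => /eqP.
Qed.

(** With enough capacity outside (i,j), the argument for P applies with (i,j) excluded.
    Otherwise the generators with zero coordinate (i,j) have degree two, hence
    sum_t x_t <= 2 + (sum a_i) x_{i,j} holds at all generators, and so on P; on
    Z_{i,j} this gives sum_t x_t = 2, a second equation. *)
Lemma facet_faceZ i (j : 'I_(tnth b i)) : (3 <= sum_a)%N ->
  facet (faceZ R a b i j) P <-> (3 <= capacity (b := b) a (predC1 (ij j)))%N.
Proof.
move=> a3; rewrite facetE //; set A := predC1 _; split=> [[_]|cap]; last first.
  split; first exact: faceZ_face.
  have inZ s : legal a s -> all A s -> (2 <= size s)%N -> faceZ R a b i j (point R s).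
    move=> leg As sz; split; first exact: point_in_P.
    rewrite ffunE (count_memPn _) //; apply/negP => /(allP As).
    by rewrite /A /= eqxx.
  have [x0 Zx0] : exists x, faceZ R a b i j x.
    apply: (exists_point (A := A)); first exact: ltnW.
    by move=> s leg As sz; apply: inZ; rewrite ?sz.
  apply: (hyperplane_affine_dim (A := pred1 (ij j)) (p0 := ij j) (c := 0) Zx0).
  - by rewrite /= eqxx.
  - by move=> x [_ xj]; rewrite big_pred1_eq.
  - by move=> t nt; apply: (unit_direction (A := A)).
  move=> t /eqP ->; rewrite subrr -(subrr x0).
  by apply: direction_sub; apply: weighted_comb_mem.
apply: contraPT; rewrite -ltnNge ltnS => cap2.
rewrite -(dim_coord_space R b).
apply: (codim2_not_facet_dim (f := weighted_sum (indic R (pred1 (ij j)))) _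
  (g := weighted_sum (indic R predT)) (c := 2)).
- by exists (unit_vec R (ij j)); rewrite /= weighted_sum_unit /indic /= eqxx oner_eq0.
- by move=> x [_ xj]; rewrite /= weighted_sum_indic big_pred1_eq.
- move=> x [Px xj]; rewrite /= weighted_sum_indic; apply/eqP; rewrite eq_le P_sum_ge2 // andbT.
  pose al t : R := 1 - sum_a%:R * indic R (pred1 (ij j)) t.
  have alE : weighted_sum al x = \sum_t x t.
    rewrite /weighted_sum; under eq_bigr do rewrite /al mulrBl mul1r -mulrA.
    rewrite sumrB -mulr_sumr -/(weighted_sum _ x) weighted_sum_indic big_pred1_eq xj.
    by rewrite mulr0 subr0.
  rewrite -alE; apply: (P_le _ Px) => e e_a _.
  have e_le : (\sum_t e t <= 2 + sum_a * e (ij j))%N.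
    have blocks : (\sum_t e t = \sum_i \sum_(t | tag t == i) e t)%N.
      by rewrite big_tagged; apply: eq_bigr => i' _; rewrite block_sumn.
    rewrite blocks; have [e0|e_gt0] := posnP (e (ij j)).
      rewrite e0 muln0 addn0 (leq_trans _ cap2) // [leqRHS]big_mkcond /=.
      apply: leq_sum => i' _; case: existsP => [_|noA]; first by rewrite block_sumn.
      rewrite big1 // => t ti'; have [->//|ntj] := eqVneq t (ij j).
      by case: noA; exists t; rewrite ti' /A /= ntj.
    rewrite (leq_trans _ (leq_addl _ _)) // (leq_trans _ (leq_pmulr _ e_gt0)) //.
    by apply: leq_sum => i' _; rewrite block_sumn.
  under eq_bigr do rewrite /al mulrBl mul1r -mulrA.
  have e_t0 : \sum_t indic R (pred1 (ij j)) t * (e t)%:R = (e (ij j))%:R.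
    rewrite (bigD1 (ij j)) //= big1 => [|t nt].
      by rewrite /indic /= eqxx mul1r addr0.
    by rewrite /indic /= (negPf nt) mul0r.
  by rewrite sumrB -mulr_sumr e_t0 lerBlDr -natr_sum -natrM -(natrD _ 2) ler_nat.
by rewrite pnatr_eq0.
Qed.


End Facets.

(** * The exceptional cases *)

Lemma capacity_predC1 k (a b : k.-tuple nat) i (j : 'I_(tnth b i)) :
  (forall i : 'I_k, (0 < tnth b i)%N) ->
  capacity (b := b) a (predC1 (ij j))
    = (\sum_(i' | (i' != i) || (1 < tnth b i)) tnth a i')%N.
Proof.
move=> b_gt0.
apply: eq_bigl => i'; apply/existsP/idP => [[p /andP[np /eqP <-]]|].
  case: eqVneq => //= tag_p; rewrite ltnNge; apply: contra np => b1.
  case: p tag_p => i1 j1 /= eq_i; subst i1; rewrite eq_Tagged /= -val_eqE /=.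
  by have := ltn_ord j1; have := ltn_ord j; lia.
have [->|ni _] := eqVneq i' i; last first.
  exists (ij (Ordinal (b_gt0 i'))); rewrite /= eqxx andbT.
  by apply: contra ni => /eqP/(congr1 tag)/= ->.
move=> /= b2; pose j' := if j == 0%N :> nat then Ordinal b2 else Ordinal (b_gt0 i).
exists (ij j'); rewrite /= eqxx andbT eq_Tagged /= -val_eqE /j'.
by case: ifP => /= j0; lia.
Qed.

Lemma sum_le2P k (a : k.-tuple nat) :
  (0 < k)%N -> (forall i : 'I_k, (0 < tnth a i)%N) ->
  (\sum_i tnth a i <= 2)%N <-> excD1 a \/ excD2 a.
Proof.
rewrite /excD1 /excD2; case: k a => [//|[|[|k']]] a _ a_pos.
- rewrite big_ord1 (tnth_nth 0%N) /=; split=> [h|[[]//|[_ //]]]; by right.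
- rewrite !big_ord_recl big_ord0 !(tnth_nth 0%N) /=.
  have := a_pos ord0; have := a_pos (lift ord0 ord0); rewrite !(tnth_nth 0%N) /=.
  case: a a_pos => -[|x [|y []]] //= _ _ x0 y0; split=> [h|].
    by left; split=> //; congr [:: _; _]; lia.
  by case=> [[_ [-> ->]]|[]].
split=> [|[[]|[]]//].
have : (\sum_(i < k'.+3) 1 <= \sum_i tnth a i)%N by apply: leq_sum => i _.
by rewrite sum1_card card_ord; lia.
Qed.

(** Each block other than [i] contributes at least one, so at most two blocks remain. *)
Lemma small_complementP k (a b : k.-tuple nat) i :
  (forall i : 'I_k, (0 < tnth a i)%N) ->
  (forall i j : 'I_k, (i <= j)%N -> (tnth a i <= tnth a j)%N) ->
  (3 <= \sum_i tnth a i)%N ->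
  (tnth b i = 1 /\ (\sum_(i' | i' != i) tnth a i' <= 2))%N <->
  [\/ excE1 a b i, excE2 a b i, excE3 a b i | excE4 a b i].
Proof.
rewrite /excE1 /excE2 /excE3 /excE4.
case: k a b i => [|[|[|[|k']]]] a b i a_pos a_sort a3.
- by case: i.
- move: a3; rewrite ord1 big_ord1 !(tnth_nth 0%N) /= big_pred0 => [|j]; last by rewrite ord1.
  by move=> a3; split=> [[b1 _]|[[]|[]|[]|[]]] //; constructor 4.
- have := a_sort ord0 (lift ord0 ord0) isT; move: a3.
  rewrite [X in (X <= 2)%N]big_mkcond !big_ord_recl !big_ord0 !(tnth_nth 0%N) /=.
  rewrite (_ : bump 0 0 = 1%N) //.
  case: i => -[|[|//]] ilt /= a3 a01.
    split=> [[b1 h]|[[]|[_ b1 _ a1 _]|[]|[]]] //; last by rewrite a1.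
    by constructor 2; split=> //; lia.
  split=> [[b1 h]|[[]|[]|[_ b1 a0 _ _]|[]]] //; last by split=> //; lia.
  by constructor 3; split=> //; lia.
- split=> [[b1 h]|[[_ b1 h]|[]|[]|[]]] //; last first.
    by split=> //; rewrite (eq_bigr _ h) sum1_card cardC1 card_ord.
  constructor 1; split=> // j ji; apply/eqP; rewrite eqn_leq a_pos andbT.
  have c2 : (\sum_(j' < 3 | (j' != i) && (j' != j)) 1 = 1)%N.
    have := cardC (pred2 i j); rewrite card2 eq_sym ji card_ord => -[c1].
    rewrite -[RHS]c1 -sum1_card.
    by apply: eq_bigl => j'; rewrite !inE negb_or.
  have : (\sum_(j' < 3 | (j' != i) && (j' != j)) 1 <=
          \sum_(j' < 3 | (j' != i) && (j' != j)) tnth a j')%N.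
    by apply: leq_sum => j' _.
  move: h; rewrite c2 (bigD1 j) //=.
  by move: (\sum_(_ < 3 | _) _)%N (tnth a j) => x y; lia.
split=> [[_ h]|[[]|[]|[]|[]]] //.
have : (\sum_(j | j != i) 1 <= \sum_(j | j != i) tnth a j)%N by apply: leq_sum => j _.
by rewrite sum1_card cardC1 card_ord; lia.
Qed.

Theorem proposition3p6 (R : realType) (k : nat) (a b : k.-tuple nat)
    (hk : (0 < k)%N)
    (ha : forall i : 'I_k, (0 < tnth a i)%N)
    (hb : forall i : 'I_k, (0 < tnth b i)%N)
    (ha_sorted : forall i j : 'I_k, (i <= j)%N -> (tnth a i <= tnth a j)%N) :
  let n := (\sum_(i < k) tnth b i)%N in
  let P := polytopeP R a b in
  [/\ (* dim P = n amounts to the secant variety having expected dimension *)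
      affine_dim P (n%:Z)%R <->
        proj_dim (secant_variety (complex R) a b) (2 * n + 1)%N,
      (* dim P = n unless (D1) or (D2) *)
      affine_dim P (n%:Z)%R <-> ~ (excD1 a \/ excD2 a),
      (* in which case P = F *)
      excD1 a \/ excD2 a -> P = faceF R a b
    & (* facets in the full-dimensional case *)
      affine_dim P (n%:Z)%R ->
      [/\ facet (faceF R a b) P,
          forall i : 'I_k, facet (faceR R a b i) P
        & forall (i : 'I_k) (j : 'I_(tnth b i)),
            facet (faceZ R a b i j) P <->
            ~ [\/ excE1 a b i, excE2 a b i, excE3 a b i | excE4 a b i]]].
Proof.
move=> n P.
have dimP : affine_dim P n%:Z <-> (3 <= \sum_i tnth a i)%N.
  split=> [|a3]; last exact/affine_dim_PE.
  apply: contraPT; rewrite -ltnNge ltnS => a2.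
  exact: P_not_full.
have dimX : proj_dim (secant_variety (complex R) a b) (2 * n + 1)%N <->
    (3 <= \sum_i tnth a i)%N.
  split=> [[[f f_indep] _]|a3].
    rewrite leqNgt ltnS; apply/negP => a2.
    apply: (defective_secant_dependent a2 _ f_indep); exact: ltnSn.
  split; last by apply: secant_variety_dependent; rewrite -/n; lia.
  by apply: secant_variety_independent => //; rewrite -/n; lia.
split.
- by rewrite dimP dimX.
- by rewrite dimP -sum_le2P // leqNgt; split=> /negP.
- by rewrite -sum_le2P //; exact: P_eq_faceF.
move/dimP => a3; split=> [|i|i j]; first exact: facet_faceF.
  exact: facet_faceR.
rewrite facet_faceZ // capacity_predC1 // -small_complementP //.
have [b1|b2] := leqP (tnth b i) 1.
  have -> : tnth b i = 1%N by have := hb i; lia.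
  rewrite (eq_bigl (fun i' => i' != i)) => [|i']; last by rewrite orbF.
  rewrite ltnNge; split=> [/negP h [_] //|h].
  by apply/negP => h'; apply: h.
rewrite (eq_bigl xpredT) => [|i']; last by rewrite orbT.
by split=> [_ [b1]|//]; rewrite b1 in b2.
Qed.
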